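(* Suppose $\sigma\in[0,2)$ is a constant, $\Omega$ is a compact subset of $\mathbb{R}^2$, and $f:(0,\infty)\to(0,\infty)$ is a continuous function satisfying $$\liminf_{s\to\infty}\frac{f(s)}{s^{-1+\frac{\sigma}{2}}}\,\frac{\prod_{i=2}^k\log^i s}{(\log s)^{1-\frac{\sigma}{2}}}>0$$ for some integer $k\ge 2$. Then there does not exist a $C^4$ positive solution $v(y)$ of $$-\Delta^2 v\ge |y|^{-\sigma}f(v)$$ in $\mathbb{R}^2\setminus\Omega$.
   Context: $\Delta^2=\Delta\circ\Delta$ is the biharmonic operator. For $i\ge 2$, $\log^i$ denotes the $i$-fold composition of $\log$: $\log^2=\log\circ\log$, $\log^3=\log\circ\log\circ\log$, etc. A $C^4$ positive solution is a $C^4$ function $v>0$ satisfying the inequality pointwise. *)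

(* Defs.v *)
From HB Require Import structures.
From mathcomp Require Import all_boot all_order all_algebra.
From mathcomp Require Import all_classical all_reals all_analysis.

Set Implicit Arguments.
Unset Strict Implicit.
Unset Printing Implicit Defensive.

Import Order.TTheory GRing.Theory Num.Theory.
Import numFieldNormedType.Exports.

Local Open Scope classical_set_scope.
Local Open Scope ring_scope.

(* The library norm `|y| on 'rV[R]_n is the sup norm. *)
Definition enorm (R : realType) (n : nat) (y : 'rV[R]_n) : R :=
  Num.sqrt (\sum_(i < n) y 0 i ^+ 2).

Definition partial (R : realType) (n : nat) (i : 'I_n) (u : 'rV[R]_n -> R)
    : 'rV[R]_n -> R :=
  fun x => 'D_(delta_mx 0 i) u x.

(* [C_on k U u]: u is of class C^k on U.  Functions are total, but for open U
   this depends only on the values of u in U. *)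
Fixpoint C_on (R : realType) (n k : nat) (U : set 'rV[R]_n)
    (u : 'rV[R]_n -> R) : Prop :=
  match k with
  | 0 => forall x, U x -> {for x, continuous u}
  | k'.+1 =>
      (forall x, U x -> {for x, continuous u}) /\
      forall i : 'I_n,
        (forall x, U x -> derivable u x (delta_mx 0 i)) /\
        C_on k' U (partial i u)
  end.

Definition laplacian (R : realType) (n : nat) (u : 'rV[R]_n -> R)
    : 'rV[R]_n -> R :=
  fun x => \sum_(i < n) partial i (partial i u) x.

Definition bilaplacian (R : realType) (n : nat) (u : 'rV[R]_n -> R)
    : 'rV[R]_n -> R :=
  laplacian (laplacian u).

(* The i-fold composition of ln.  Since ln is total, the value is meaningful
   only for s large enough (depending on i). *)
Definition iter_ln (R : realType) (i : nat) (s : R) : R := iter i (@ln R) s.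

(* If sigma != 0 then 0 `^ (- sigma) = 0 by convention, so that when the origin
   lies in U the inequality there only says - bilaplacian v 0 >= 0: less is
   required of a solution than under the convention 0 `^ (- sigma) = +oo. *)
Definition C4_positive_solution (R : realType) (sigma : R) (f : R -> R)
    (U : set 'rV[R]_2) (v : 'rV[R]_2 -> R) : Prop :=
  [/\ C_on 4 U v,
      forall y, U y -> 0 < v y &
      forall y, U y -> - bilaplacian v y >= enorm y `^ (- sigma) * f (v y)].

(* Main.v *)
(* Averaging [v] over circles centred at the origin turns [- bilaplacian v = g >= 0]
   into a radial system: with [t = ln r], [V] the integral of [v] over the circle
   of radius [r] and [Z] that of its Laplacian, [V'' = e^(2t) Z] and
   [Z'' = - H <= 0].  Positivity of [V] forces [Z' >= 0], hence
   [V <= C t e^(2t)]; moreover [V] is eventually nondecreasing and doubling.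
   Since [f] may vanish at [0+], averages alone do not bound [f(v)] from below:
   [v] could concentrate on a small part of each circle.  This is excluded by a
   mean value inequality [3 v(x) <= 4 avg v] on small circles around [x], which,
   integrated against a cutoff and recentred at the origin, gives
   [v <= 128 V(2r)] on the circle of radius [r].  Hence [v] is comparable to its
   average on a fixed proportion of the circle, and there
   [f(v) >= e v^(-1 + sigma/2)], which yields [H >= c / t].  This contradicts the
   integrability of [H = - Z''].  Only this weaker power bound on [f] is used: it
   follows from the hypothesis because a product of iterated logarithms is
   dominated by [(ln s)^(1 - sigma/2)]. *)

Require Import Defs.
From HB Require Import structures.
From mathcomp Require Import all_boot all_order all_algebra.
From mathcomp Require Import all_classical all_reals all_analysis.
From mathcomp Require Import ring lra.

Set Implicit Arguments.
Unset Strict Implicit.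
Unset Printing Implicit Defensive.

Import Order.TTheory GRing.Theory Num.Theory.
Import numFieldNormedType.Exports.

Local Open Scope classical_set_scope.
Local Open Scope ring_scope.

(** * Radial differential inequalities *)

Section RealDerivatives.
Context {R : realType}.
Implicit Types (f g df : R -> R) (a b t x : R).

(** With [b = 1 - sigma / 2] the exponents balance exactly: the weight [r^(-sigma)], the factor
    [e^(2t)] in [H] and the bound [V^(-b) >= (C t e^(2t))^(-b)] multiply to a constant times
    [t^(-b)], and [b <= 1] leaves the borderline non-integrable rate [1 / t]. Losing any positive
    power of [r] in the growth bound would ruin the argument. The good part of a circle is never
    measured: [f(v)] is bounded below by an affine function of [v], negative for small [v], whose
    circular integral involves only [V]. No planar integral occurs as such. Disc integrals are
    iterated one-dimensional integrals in polar coordinates, so recentring is obtained by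
    differentiating in the centre, not by a change of variables. *)

Lemma is_derive_continuous f x (d : R) : is_derive x 1 f d -> {for x, continuous f}.
Proof.
by move=> [H _]; apply/differentiable_continuous/derivable1_diffP.
Qed.

Lemma is_derive_mean_value f df a b : a <= b ->
  (forall x, a <= x <= b -> is_derive x 1 f (df x)) ->
  exists2 c, a <= c <= b & f b - f a = df c * (b - a).
Proof.
move=> ab H; have [x||c] := @MVT_segment R f df a b ab; last first.
- by rewrite in_itv /= => cab ->; exists c.
- apply: continuous_in_subspaceT => x; rewrite inE /= in_itv /= => xab.
  exact: is_derive_continuous (H x xab).
- by rewrite in_itv /= => /andP[x1 x2]; apply: H; rewrite !ltW.
Qed.

Lemma is_derive_le f df a b (M : R) : a <= b ->
  (forall x, a <= x <= b -> is_derive x 1 f (df x)) ->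
  (forall x, a <= x <= b -> df x <= M) -> f b - f a <= M * (b - a).
Proof.
move=> ab H HM; have [c cab ->] := is_derive_mean_value ab H.
by apply: ler_wpM2r; [rewrite subr_ge0 | apply: HM].
Qed.

Lemma is_derive_ge f df a b (M : R) : a <= b ->
  (forall x, a <= x <= b -> is_derive x 1 f (df x)) ->
  (forall x, a <= x <= b -> M <= df x) -> M * (b - a) <= f b - f a.
Proof.
move=> ab H HM; have [c cab ->] := is_derive_mean_value ab H.
by apply: ler_wpM2r; [rewrite subr_ge0 | apply: HM].
Qed.

Lemma is_derive_shift_arg f x (d s : R) :
  is_derive (x + s) 1 f d -> is_derive x 1 (fun y => f (y + s)) d.
Proof.
move=> H; have H2 : is_derive x (1 : R) (fun y : R => y + s) 1.
  by apply: is_derive_eq; rewrite addr0.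
have := @is_derive1_comp R f (fun y => y + s) x d 1 H H2.
by rewrite mulr1.
Qed.

Lemma is_derive_lincomb f g x (c df1 dg1 : R) :
  is_derive x 1 f df1 -> is_derive x 1 g dg1 ->
  is_derive x 1 (fun y => f y - c * g y) (df1 - c * dg1).
Proof.
move=> Hf Hg; apply: is_derive_eq.
by rewrite /GRing.scale /=; ring.
Qed.

End RealDerivatives.

(** * Eventual comparison for the radial system *)

Section RadialODE.
Context {R : realType}.
Implicit Types (a b t s : R).

Lemma eventually_below (Y Y1 : R -> R) (T z B : R) : 0 < z ->
  (forall t, T < t -> is_derive t 1 Y (Y1 t)) ->
  (forall t, T < t -> Y1 t <= - z) ->
  exists T' : R, forall t, T' < t -> Y t <= B.
Proof.
(* The quotient is the time that slope [- z] needs to descend to [B]; the start is [T + 1] because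
   derivatives are known only beyond [T]. *)
move=> z0 dY Y1z; exists (T + 1 + `|(Y (T + 1) - B) / z|) => t Tt.
have Tt1 : T + 1 <= t by have := normr_ge0 ((Y (T + 1) - B) / z); lra.
have := @is_derive_le R Y Y1 (T + 1) t (- z) Tt1.
have H1 x : T + 1 <= x <= t -> T < x by lra.
move=> /(_ (fun x hx => dY x (H1 x hx)) (fun x hx => Y1z x (H1 x hx))).
have h : (Y (T + 1) - B) / z < t - (T + 1).
  by have := ler_norm ((Y (T + 1) - B) / z); lra.
move: h; rewrite ltr_pdivrMr // => h; nra.
Qed.

(** The form in which growth comparisons are made: for [Y] a function minus its candidate majorant,
    no initial data need match, since a uniformly negative second derivative eventually wins. *)
Lemma eventually_below2 (Y Y1 Y2 : R -> R) (T z : R) : 0 < z ->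
  (forall t, T < t -> is_derive t 1 Y (Y1 t)) ->
  (forall t, T < t -> is_derive t 1 Y1 (Y2 t)) ->
  (forall t, T < t -> Y2 t <= - z) ->
  exists T' : R, forall t, T' < t -> Y t <= 0.
Proof.
move=> z0 dY dY1 Y2z.
have [T1 H1] := eventually_below (-1) z0 dY1 Y2z.
apply: (@eventually_below Y Y1 (Num.max T T1) 1); first lra.
- by move=> t; rewrite gt_max => /andP[? _]; apply: dY.
- by move=> t; rewrite gt_max => /andP[_ ?]; apply: H1.
Qed.

Variables (V V1 Z Z1 H : R -> R) (T0 : R).
Hypothesis T0_ge1 : 1 <= T0.
Hypothesis dV : forall t, T0 < t -> is_derive t 1 V (V1 t).
Hypothesis dV1 : forall t, T0 < t -> is_derive t 1 V1 (expR (2 * t) * Z t).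
Hypothesis dZ : forall t, T0 < t -> is_derive t 1 Z (Z1 t).
Hypothesis dZ1 : forall t, T0 < t -> is_derive t 1 Z1 (- H t).
Hypothesis H_ge0 : forall t, T0 < t -> 0 <= H t.
Hypothesis V_gt0 : forall t, T0 < t -> 0 < V t.

Let expR2_ge1 t : T0 < t -> 1 <= expR (2 * t).
Proof. by move=> ?; rewrite -[leLHS]expR0 ler_expR; move: T0_ge1; lra. Qed.

Lemma radial_Z1_nonincr a b : T0 < a -> a <= b -> Z1 b <= Z1 a.
Proof.
move=> Ta ab.
have := @is_derive_le R Z1 (fun t => - H t) a b 0 ab.
rewrite mul0r subr_le0; apply=> x xab.
- by apply: dZ1; lra.
- by rewrite oppr_le0; apply: H_ge0; lra.
Qed.

(** A negative value of [Z1] would persist by monotonicity, so [Z <= -1] eventually; as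
    [e^(2t) >= 1], this makes [V'' <= -1] and drives [V] below zero. *)
Lemma radial_Z1_ge0 t : T0 < t -> 0 <= Z1 t.
Proof.
move=> Tt; rewrite leNgt; apply/negP => Z1t.
have [T1 HT1] : exists T1, forall s, T1 < s -> Z s <= - 1.
  apply: (@eventually_below Z Z1 t (- Z1 t)); first by rewrite oppr_gt0.
  - by move=> s ts; apply: dZ; lra.
  - by move=> s ts; rewrite opprK; apply: radial_Z1_nonincr => //; apply: ltW.
have [T2 HT2] : exists T' : R, forall s, T' < s -> V s <= 0.
  apply: (@eventually_below2 V V1 (fun s => expR (2 * s) * Z s)
            (Num.max T0 T1) 1); first lra.
  - by move=> s; rewrite gt_max => /andP[? _]; apply: dV.
  - by move=> s; rewrite gt_max => /andP[? _]; apply: dV1.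
  - move=> s; rewrite gt_max => /andP[/expR2_ge1 s1 /HT1 s2]; nra.
pose s := Num.max T0 T2 + 1.
have sT : Num.max T0 T2 < s by rewrite /s; lra.
move: sT; rewrite gt_max => /andP[/V_gt0 h1 /HT2 h2]; lra.
Qed.

Lemma radial_Z_nondecr a b : T0 < a -> a <= b -> Z a <= Z b.
Proof.
move=> Ta ab.
have := @is_derive_ge R Z Z1 a b 0 ab.
rewrite mul0r subr_ge0; apply=> x xab.
- by apply: dZ; lra.
- by apply: radial_Z1_ge0; lra.
Qed.

(** [Z] is concave, hence at most [C t], so [V'' <= C t e^(2t)]. The comparison function [t e^(2t)]
    has second derivative [(4t + 4) e^(2t)], large enough to win with the same [C]. *)
Lemma radial_growth : exists C T : R, [/\ 1 <= C, T0 <= T &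
  forall t, T < t -> V t <= C * (t * expR (2 * t))].
Proof.
pose t0 := T0 + 1.
have t0T : T0 < t0 by rewrite /t0; lra.
pose C := `|Z t0| + Z1 t0 + 1.
have Z1p : 0 <= Z1 t0 by apply: radial_Z1_ge0.
have C1 : 1 <= C by rewrite /C; have := normr_ge0 (Z t0); lra.
have HZ t : t0 <= t -> Z t <= C * t.
  move=> t0t.
  have := @is_derive_le R Z Z1 t0 t (Z1 t0) t0t.
  have h x : t0 <= x <= t -> is_derive x 1 Z (Z1 x).
    by move=> ?; apply: dZ; lra.
  have h2 x : t0 <= x <= t -> Z1 x <= Z1 t0.
    by move=> /andP[? ?]; apply: radial_Z1_nonincr.
  move=> /(_ h h2) h3.
  have := ler_norm (Z t0); have := normr_ge0 (Z t0).
  have : 1 <= t by move: T0_ge1; lra.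
  have : 0 <= t0 by move: T0_ge1; lra.
  rewrite /C; nra.
pose E (t : R) := t * expR (2 * t).
pose E1 (t : R) := (1 + 2 * t) * expR (2 * t).
pose E2 (t : R) := (4 * t + 4) * expR (2 * t).
have dexp2 (t : R) : is_derive t 1 (fun s : R => expR (2 * s)) (2 * expR (2 * t)).
  have h : is_derive t 1 (fun s : R => 2 * s) (2 : R).
    by apply: is_derive_eq; rewrite /GRing.scale /= mulr1.
  by have := @is_derive1_comp R expR _ t _ _ (is_derive_expR _) h; rewrite mulrC.
have dE (t : R) : is_derive t 1 E (E1 t).
  apply: is_derive_eq; rewrite /E1 /GRing.scale /=; ring.
have dE1 (t : R) : is_derive t 1 E1 (E2 t).
  apply: is_derive_eq; rewrite /E2 /GRing.scale /=; ring.
have [T HT] : exists T' : R, forall t, T' < t -> V t - C * E t <= 0.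
  apply: (@eventually_below2 _ (fun t => V1 t - C * E1 t)
            (fun t => expR (2 * t) * Z t - C * E2 t) t0 1); first lra.
  - move=> t t0t; apply: is_derive_lincomb => //; apply: dV; lra.
  - move=> t t0t; apply: is_derive_lincomb => //; apply: dV1; lra.
  - move=> t t0t; have tT : T0 < t by lra.
    have e1 := expR2_ge1 tT; have := HZ t (ltW t0t).
    have t1 : 1 <= t by move: T0_ge1; lra.
    rewrite /E2 /= => hz.
    have h1 : expR (2 * t) * Z t <= expR (2 * t) * (C * t).
      by apply: ler_wpM2l => //; lra.
    have h2 : 1 <= expR (2 * t) * C by nra.
    have h3 : 0 <= expR (2 * t) * C * t by apply: mulr_ge0; lra.
    nra.
exists C, (Num.max T0 T); split=> //; first by rewrite le_max lexx.
by move=> t; rewrite gt_max => /andP[_ /HT]; rewrite subr_le0.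
Qed.

(** Shifting [t] by [a] multiplies the radius by [e^a]. If [Z] is ever positive it stays so, [V']
    increases without bound, and [V (t + a)] is compared with [K V t] through second derivatives.
    Otherwise [V] is concave and positive, so [V' >= 0] and the increment over [[t, t + a]] is at
    most the one over [[t - a, t]], whence the factor 2. *)
Lemma radial_monotone_doubling (a : R) : 0 < a -> exists K T : R,
  [/\ 1 <= K, T0 <= T, forall t, T < t -> 0 <= V1 t &
      forall t, T < t -> V (t + a) <= K * V t].
Proof.
move=> a0; have [[t1 [Tt1 Zt1]]|Znp] := pselect (exists t1, T0 < t1 /\ 0 < Z t1).
- pose e := expR (2 * a); have e0 : 0 < e by apply: expR_gt0.
  (* [2 e] bounds the ratio of [V''] at [t + a] and at [t]; the extra 1 leaves the negative amount
     [- e^(2t) Z t], at most [- Z t1]. *)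
  pose K := 2 * e + 1.
  have Zp t : t1 <= t -> Z t1 <= Z t by move=> ?; apply: radial_Z_nondecr.
  have [T2 HT2] : exists T2, forall t, T2 < t -> - V1 t <= 0.
    apply: (@eventually_below _ (fun t => - (expR (2 * t) * Z t)) t1 (Z t1)) => //.
    + by move=> t t1t; apply: is_deriveN; apply: dV1; lra.
    + move=> t t1t; have := Zp t (ltW t1t).
      have : 1 <= expR (2 * t) by apply: expR2_ge1; lra.
      nra.
  (* Concavity: the gain of [Z] over [[t, t + a]] is at most its gain over the longer interval
     [[t1, t]], which is at most [Z t] since [Z t1 > 0]. *)
  have Zdbl t : t1 + a < t -> Z (t + a) <= 2 * Z t.
    move=> t1t.
    have := @is_derive_le R Z Z1 t (t + a) (Z1 t).
    have := @is_derive_ge R Z Z1 t1 t (Z1 t).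
    rewrite (_ : t + a - t = a); last ring.
    move=> h1 h2.
    have {}h1 : Z1 t * (t - t1) <= Z t - Z t1.
      apply: h1; first lra.
      - by move=> x ?; apply: dZ; lra.
      - by move=> x ?; apply: radial_Z1_nonincr; lra.
    have {}h2 : Z (t + a) - Z t <= Z1 t * a.
      apply: h2; first lra.
      - by move=> x ?; apply: dZ; lra.
      - by move=> x ?; apply: radial_Z1_nonincr; lra.
    have h3 : 0 <= Z1 t by apply: radial_Z1_ge0; lra.
    nra.
  have [T3 HT3] : exists T' : R, forall t, T' < t -> V (t + a) - K * V t <= 0.
    apply: (@eventually_below2 _ (fun t => V1 (t + a) - K * V1 t)
       (fun t => expR (2 * (t + a)) * Z (t + a) - K * (expR (2 * t) * Z t))
       (t1 + a) (Z t1)) => //.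
    + move=> t ht; apply: is_derive_lincomb.
      * by apply: is_derive_shift_arg; apply: dV; lra.
      * by apply: dV; lra.
    + move=> t ht; apply: is_derive_lincomb.
      * by apply: (@is_derive_shift_arg _ V1); apply: dV1; lra.
      * by apply: dV1; lra.
    + move=> t ht; have h1 := Zdbl t ht; have h2 : Z t1 <= Z t by apply: Zp; lra.
      have h3 : 1 <= expR (2 * t) by apply: expR2_ge1; lra.
      rewrite (_ : 2 * (t + a) = 2 * a + 2 * t); last ring.
      rewrite expRD -/e.
      have h4 : e * expR (2 * t) * Z (t + a) <= e * expR (2 * t) * (2 * Z t).
        by apply: ler_wpM2l => //; apply: mulr_ge0; lra.
      rewrite /K; nra.
  exists K, (Num.max T0 (Num.max T2 T3)); split.
  + by rewrite /K; lra.
  + by rewrite le_max lexx.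
  + by move=> t; rewrite !gt_max => /and3P[_ /HT2 ? _]; lra.
  + by move=> t; rewrite !gt_max => /and3P[_ _ /HT3]; rewrite subr_le0.
- have Zle t : T0 < t -> Z t <= 0.
    by move=> Tt; rewrite leNgt; apply/negP => ?; apply: Znp; exists t.
  have V1_nonincr s t : T0 < s -> s <= t -> V1 t <= V1 s.
    move=> Ts st; have := @is_derive_le R V1 (fun t => expR (2 * t) * Z t) s t 0 st.
    rewrite mul0r subr_le0; apply=> x xst; first by apply: dV1; lra.
    by apply: mulr_ge0_le0; [exact: expR_ge0 | apply: Zle; lra].
  have V1_ge0 t : T0 < t -> 0 <= V1 t.
    move=> Tt; rewrite leNgt; apply/negP => V1t.
    have [T1 HT1] : exists T1, forall s, T1 < s -> V s <= 0.
      apply: (@eventually_below V V1 t (- V1 t)); first by rewrite oppr_gt0.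
      - by move=> s ts; apply: dV; lra.
      - by move=> s ts; rewrite opprK; apply: V1_nonincr => //; apply: ltW.
    have sT : Num.max T0 T1 < Num.max T0 T1 + 1 by lra.
    by move: sT; rewrite gt_max => /andP[/V_gt0 h1 /HT1 h2]; lra.
  exists 2, (T0 + a); split=> //; [lra|lra| |].
  + by move=> t ht; apply: V1_ge0; lra.
  + move=> t ht; pose s := t - a.
    have h1 := @is_derive_ge R V V1 s t (V1 t).
    have h2 := @is_derive_le R V V1 t (t + a) (V1 t).
    have sE : t - s = a by rewrite /s; ring.
    have {}h1 : V1 t * a <= V t - V s.
      rewrite -[X in _ * X]sE; apply: h1; first by rewrite /s; lra.
      - by move=> x; rewrite /s => ?; apply: dV; lra.
      - by move=> x; rewrite /s => ?; apply: V1_nonincr; lra.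
    have {}h2 : V (t + a) - V t <= V1 t * a.
      rewrite (_ : V1 t * a = V1 t * (t + a - t)); last ring.
      apply: h2; first lra.
      - by move=> x ?; apply: dV; lra.
      - by move=> x ?; apply: V1_nonincr; lra.
    have : 0 < V s by apply: V_gt0; rewrite /s; lra.
    lra.
Qed.

(** The substitution [t = e^s] turns the divergence of the integral of [1 / t] into a constant
    slope: [Z1 (e^s)] has derivative at most [- c] in [s], against [Z1 >= 0]. *)
Lemma radial_contradiction (c T : R) : 0 < c -> T0 <= T ->
  (forall t, T < t -> c / t <= H t) -> False.
Proof.
move=> c0 TT HH.
have [T' HT'] : exists T' : R, forall t, T' < t -> Z1 (expR t) <= - 1.
  apply: (@eventually_below _ (fun t => - H (expR t) * expR t) T c) => //.
  - move=> t Tt; apply: (@is_derive1_comp R Z1 expR); apply: dZ1.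
    by have := expR_ge1Dx t; lra.
  - move=> t Tt; have h := expR_ge1Dx t.
    have := HH (expR t); rewrite ler_pdivrMr ?expR_gt0 // => h'.
    by rewrite mulNr lerN2; apply: h'; lra.
pose t := Num.max T T' + 1.
have : Num.max T T' < t by rewrite /t; lra.
rewrite gt_max => /andP[Tt /HT' h].
have : 0 <= Z1 (expR t) by apply: radial_Z1_ge0; have := expR_ge1Dx t; lra.
lra.
Qed.

End RadialODE.

(** * Integrals over a segment *)

Section PointwiseContinuity.
Context {R : realType} {T : topologicalType}.
Implicit Types (f g : T -> R) (t : T).

(* [continuousD] and its siblings are stated for [f + g], which does not match
   a sum under a binder. *)
Lemma continuous_at_add f g t : continuous_at t f -> continuous_at t g ->
  continuous_at t (fun z => f z + g z).
Proof. exact: continuousD. Qed.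

Lemma continuous_at_sub f g t : continuous_at t f -> continuous_at t g ->
  continuous_at t (fun z => f z - g z).
Proof. exact: continuousB. Qed.

Lemma continuous_at_mul f g t : continuous_at t f -> continuous_at t g ->
  continuous_at t (fun z => f z * g z).
Proof. exact: continuousM. Qed.

Lemma continuous_at_cst (c : R) t : continuous_at t (fun _ : T => c).
Proof. exact: cvg_cst. Qed.

End PointwiseContinuity.

(* Higher-order unification does not find the two operands by itself. *)
Ltac continuity_step :=
  lazymatch goal with
  | |- @prop_for _ _ _ _ => cbv beta delta [prop_for]
  | |- continuous_at ?t (fun z => Algebra.add (@?f z) (Algebra.opp (@?g z))) =>
      apply: (@continuous_at_sub _ _ f g t)
  | |- continuous_at ?t (fun z => Algebra.add (@?f z) (@?g z)) =>
      apply: (@continuous_at_add _ _ f g t)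
  | |- continuous_at ?t (fun z => GRing.mul (@?f z) (@?g z)) =>
      apply: (@continuous_at_mul _ _ f g t)
  | |- continuous_at ?t (fun=> ?c) => exact: (@continuous_at_cst _ _ c t)
  | |- continuous_at ?t (fun z => z) => exact: cvg_id
  end.

Ltac continuity :=
  repeat match goal with H : @prop_for _ _ _ _ |- _ => cbv beta delta [prop_for] in H end;
  repeat first [ match goal with
                 | H : continuous_at ?t ?F |- continuous_at ?t ?F => exact H
                 | H : forall x, continuous_at x ?F |- continuous_at _ ?F => exact (H _)
                 end
               | continuity_step ].

Section SegmentIntegral.
Context {R : realType}.
Implicit Types (f g F : R -> R) (a b x : R).

Definition segint a b f : R := \int[lebesgue_measure]_(x in `[a, b]) f x.

Lemma segint_integrable a b f : continuous f ->
  (@lebesgue_measure R).-integrable `[a, b] (EFin \o f).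
Proof.
move=> cf; apply: continuous_compact_integrable; first exact: segment_compact.
exact: continuous_subspaceT.
Qed.

Lemma eq_segint a b f g : (forall x, a <= x <= b -> f x = g x) ->
  segint a b f = segint a b g.
Proof.
by move=> fg; apply: eq_Rintegral => x; rewrite inE /= in_itv /=; apply: fg.
Qed.

Lemma segintD a b f g : continuous f -> continuous g ->
  segint a b (fun x => f x + g x) = segint a b f + segint a b g.
Proof. by move=> ? ?; apply: RintegralD => //; apply: segint_integrable. Qed.

Lemma segintB a b f g : continuous f -> continuous g ->
  segint a b (fun x => f x - g x) = segint a b f - segint a b g.
Proof. by move=> ? ?; apply: RintegralB => //; apply: segint_integrable. Qed.

Lemma segintZ a b c f : continuous f ->
  segint a b (fun x => c * f x) = c * segint a b f.
Proof. by move=> ?; apply: RintegralZl => //; apply: segint_integrable. Qed.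

Lemma segint_cst a b c : a <= b -> segint a b (fun=> c) = c * (b - a).
Proof.
move=> ab; rewrite /segint Rintegral_cst //= lebesgue_measure_itv /= lte_fin.
by case: ltP => // ba; rewrite (@le_anti _ _ a b) ?ab ?ba // subrr.
Qed.

Lemma segint_le a b f g : continuous f -> continuous g ->
  (forall x, a <= x <= b -> f x <= g x) -> segint a b f <= segint a b g.
Proof.
by move=> cf cg fg; apply: le_Rintegral => //; apply: segint_integrable.
Qed.

Lemma segint_norm_le a b f M : a <= b -> continuous f ->
  (forall x, a <= x <= b -> `|f x| <= M) -> `|segint a b f| <= M * (b - a).
Proof.
move=> ab cf fM; rewrite ler_norml -mulNr -!(segint_cst _ ab).
have cc (c : R) : continuous (fun _ : R => c) by move=> ?; exact: cvg_cst.
by rewrite !segint_le // => x /fM; rewrite ler_norml => /andP[].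
Qed.

Lemma segint_derive a b F f : a < b -> continuous f ->
  (forall x, is_derive x 1 F (f x)) -> segint a b f = F b - F a.
Proof.
move=> ab cf dF; rewrite /segint /Rintegral (@continuous_FTC2 R f F a b) //.
- exact: continuous_subspaceT.
- have cF : continuous F by move=> x; exact: is_derive_continuous (dF x).
  split.
  + by move=> x _; case: (dF x).
  + by apply: cvg_at_right_filter; apply: cF.
  + by apply: cvg_at_left_filter; apply: cF.
- by move=> x _; rewrite derive1E; case: (dF x).
Qed.

(** The tube lemma: continuity at the points of a compact slice yields one neighbourhood of [s0]
    that serves all [y]. *)
Lemma tube_continuous (T : topologicalType) (k : T -> R -> R) (s0 : T) a b (e : R) :
  (forall y, a <= y <= b -> {for (s0, y), continuous (fun z => k z.1 z.2)}) ->
  0 < e -> \forall s \near s0, forall y, a <= y <= b -> `|k s y - k s0 y| < e.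
Proof.
move=> ck e0.
have [+ _] := compact_near_coveringP (`[a, b] : set R).
move=> /(_ (@segment_compact _ a b)) NC.
have h : (forall x : R, [set` `[a, b]] x -> \forall x' \near x & i \near s0,
    `|k i x' - k s0 x'| < e).
  move=> y; rewrite /= in_itv /= => /ck cy.
  have e2 : 0 < e / 2 by lra.
  have /cvgrPdist_lt /(_ _ e2) [[A B] /= [As By] AB] := cy.
  exists (B, A) => //= -[y' s] /= [By' As'].
  have h1 := AB (s, y') (conj As' By').
  have h2 := AB (s0, y') (conj (nbhs_singleton As) By').
  rewrite /= in h1 h2.
  rewrite (_ : k s y' - k s0 y' = (k s0 y - k s0 y') - (k s0 y - k s y')); last ring.
  by apply: (le_lt_trans (ler_normB _ _)); rewrite (splitr e) ltrD.
have := NC T (nbhs s0) (fun s y => `|k s y - k s0 y| < e) (nbhs_filter s0) h.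
apply: filterS => s hs y yab; apply: hs.
by rewrite /= in_itv.
Qed.

Lemma continuous_segint (T : topologicalType) (k : T -> R -> R) (s0 : T) a b :
  a <= b ->
  (forall y, a <= y <= b -> {for (s0, y), continuous (fun z => k z.1 z.2)}) ->
  (\forall s \near s0, continuous (k s)) ->
  {for s0, continuous (fun s => segint a b (k s))}.
Proof.
move=> ab ck cks; apply/cvgrPdist_lt => e e0.
(* The [+ 1] keeps the denominator positive when [a = b] and makes the final bound strict. *)
have d0 : 0 < e / (b - a + 1) by rewrite divr_gt0 //; lra.
have c0 : continuous (k s0) by apply: (nbhs_singleton cks).
have := tube_continuous ck d0.
apply: filterS2 cks => s cs hs.
rewrite -segintB //; apply: (@le_lt_trans _ _ (e / (b - a + 1) * (b - a))).
  apply: segint_norm_le => //.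
    by move=> y; apply: cvgB; [apply: c0 | apply: cs].
  by move=> y /hs /ltW; rewrite distrC.
by rewrite mulrAC ltr_pdivrMr; nra.
Qed.

Lemma is_derive_mean_value_dist (f df : R -> R) (x0 x : R) :
  (forall z, `|z - x0| <= `|x - x0| -> is_derive z 1 f (df z)) ->
  exists2 c, `|c - x0| <= `|x - x0| & f x - f x0 = df c * (x - x0).
Proof.
move=> H; have [x0x|xx0] := leP x0 x.
- have [|c cx ->] := @is_derive_mean_value R f df x0 x x0x.
    by move=> z ?; apply: H; rewrite !ger0_norm; lra.
  by exists c => //; rewrite !ger0_norm; lra.
- have [|c cx E] := @is_derive_mean_value R f df x x0 (ltW xx0).
    by move=> z ?; apply: H; rewrite !ler0_norm; lra.
  by exists c; [rewrite !ler0_norm; lra | rewrite -opprB E; ring].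
Qed.

Lemma is_derive_of_estimate (f : R -> R) (x d : R) :
  (forall e, 0 < e ->
     \forall z \near x, `|f z - f x - d * (z - x)| <= e * `|z - x|) ->
  is_derive x 1 f d.
Proof.
move=> H; apply/is_derive1_caratheodory.
exists (fun z => if z == x then d else (f z - f x) / (z - x)); split; last by rewrite eqxx.
- move=> z; case: eqP => [->|/eqP]; first by rewrite !subrr mulr0.
  by rewrite -subr_eq0 => /divfK->.
- apply/cvgrPdist_le => e e0; have := H e e0; rewrite eqxx; apply: filterS => z hz.
  case: eqVneq => [_|zx]; first by rewrite subrr normr0 ltW.
  have zx0 : 0 < `|z - x| by rewrite normr_gt0 subr_eq0.
  rewrite -(ler_pM2r zx0) -normrM mulrBl divfK ?subr_eq0 //.
  by rewrite -normrN opprB.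
Qed.

(** By the mean value theorem in [s], the linearisation error is [(s - s0) (k' c y - k' s0 y)],
    uniformly small in [y] by the tube lemma; no dominated convergence is involved. *)
Lemma is_derive_segint (k k' : R -> R -> R) (s0 : R) a b : a <= b ->
  (\forall s \near s0, continuous (k s)) -> continuous (k' s0) ->
  (\forall s \near s0, forall y, a <= y <= b -> is_derive (s : R) 1 (k ^~ y) (k' s y)) ->
  (forall y, a <= y <= b -> {for (s0, y), continuous (fun z => k' z.1 z.2)}) ->
  is_derive s0 1 (fun s => segint a b (k s)) (segint a b (k' s0)).
Proof.
move=> ab ck ck' dk cj; apply: is_derive_of_estimate => e e0.
have d0 : 0 < e / (b - a + 1) by rewrite divr_gt0 //; lra.
have c0 : continuous (k s0) by apply: (nbhs_singleton ck).
(* A ball, so that the intermediate points of the mean value theorem stay inside. *)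
have [r /= r0 Hr] := (nbhs_ballP _ _).1
  (filterI dk (@tube_continuous _ k' s0 a b _ cj d0)).
have := nbhsx_ballx s0 r r0.
apply: filterS2 ck => s cs sr.
have cm c : continuous (fun y => c * k' s0 y).
  by move=> y; apply: cvgM; [exact: cvg_cst | apply: ck'].
have -> : segint a b (k s) - segint a b (k s0) - segint a b (k' s0) * (s - s0) =
   segint a b (fun y => k s y - k s0 y - (s - s0) * k' s0 y).
  rewrite segintB // ?segintB ?segintZ //; first by rewrite [in RHS]mulrC.
  by move=> y; apply: cvgB; [apply: cs | apply: c0].
apply: (@le_trans _ _ (e / (b - a + 1) * `|s - s0| * (b - a))).
  apply: segint_norm_le => //.
    move=> y; apply: cvgB; last exact: cm.
    by apply: cvgB; [apply: cs | apply: c0].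
  move=> y yab.
  have [|c cs0 ->] := @is_derive_mean_value_dist (k ^~ y) (k' ^~ y) s0 s.
    move=> z zs; apply: (Hr z _).1 => //.
    by rewrite /ball /= distrC (le_lt_trans zs) // distrC.
  rewrite mulrC -mulrBr normrM mulrC ler_wpM2r //.
  apply: ltW; apply: (Hr c _).2 => //.
  by rewrite /ball /= distrC (le_lt_trans cs0) // distrC.
rewrite mulrAC ler_wpM2r // mulrAC ler_pdivrMr; nra.
Qed.

End SegmentIntegral.

(** * Calculus in the plane *)

Section Plane.
Context {R : realType}.
Implicit Types (y t s : R) (U : set 'rV[R]_2) (u v h : 'rV[R]_2 -> R).

Definition pt (x y : R) : 'rV[R]_2 := \row_j (if j == 0 then x else y).

Lemma pt0 (x y : R) : pt x y 0 0 = x. Proof. by rewrite mxE. Qed.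
Lemma pt1 (x y : R) : pt x y 0 1 = y. Proof. by rewrite mxE. Qed.

Lemma ord2_ind (P : 'I_2 -> Prop) : P 0 -> P 1 -> forall i, P i.
Proof.
move=> P0 P1 i; case: (eqVneq i 0) => [->//|i0].
have -> // : i = 1 by apply/val_inj; case: i i0 => [[|[|]]].
Qed.

Lemma ptE (p : 'rV[R]_2) : p = pt (p 0 0) (p 0 1).
Proof. by apply/rowP; apply: ord2_ind; rewrite !mxE. Qed.

Lemma sum_ord2 (F : 'I_2 -> R) : \sum_(i < 2) F i = F 0 + F 1.
Proof.
rewrite big_ord_recl big_ord1; congr (F _ + F _); exact: val_inj.
Qed.

Lemma ball_pt (x y e : R) (q : 'rV[R]_2) :
  ball (pt x y) e q <-> ball x e (q 0 0) /\ ball y e (q 0 1).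
Proof.
split=> [[e0 H]|[H0 H1]].
  by have := H 0 0; have := H 0 1; rewrite !mxE.
split; first by apply: le_lt_trans H0; exact: normr_ge0.
by move=> i; rewrite (ord1 i); apply: ord2_ind; rewrite mxE.
Qed.

Lemma continuous_pt (T : topologicalType) (X Y : T -> R) (t : T) :
  {for t, continuous X} -> {for t, continuous Y} ->
  {for t, continuous (fun z => pt (X z) (Y z))}.
Proof.
move=> cX cY; apply/cvg_ballP => e e0.
have := cY _ (nbhsx_ballx (Y t) e e0); have := cX _ (nbhsx_ballx (X t) e e0).
rewrite !near_simpl; apply: filterS2 => s HX HY.
by apply/ball_pt; rewrite !mxE.
Qed.

Lemma delta_mx0 : delta_mx 0 0 = pt 1 0 :> 'rV[R]_2.
Proof. by apply/rowP; apply: ord2_ind; rewrite !mxE. Qed.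
Lemma delta_mx1 : delta_mx 0 1 = pt 0 1 :> 'rV[R]_2.
Proof. by apply/rowP; apply: ord2_ind; rewrite !mxE. Qed.

Lemma ptZD (a x y b c : R) : a *: pt x y + pt b c = pt (a * x + b) (a * y + c).
Proof. by apply/rowP; apply: ord2_ind; rewrite !mxE. Qed.

Lemma is_derive_delta0P u (x y d : R) :
  is_derive (pt x y) (delta_mx 0 0) u d <-> is_derive x 1 (fun s => u (pt s y)) d.
Proof.
rewrite delta_mx0.
have E : (fun t : R => t^-1 *: (u (pt (t *: 1 + x) y) - u (pt x y))) =
         (fun t : R => t^-1 *: (u (t *: pt 1 0 + pt x y) - u (pt x y))).
  by apply/funext => t; rewrite ptZD mulr0 add0r.
split=> -[/= H1 H2]; split; move: H1 H2; rewrite /derivable /derive /= E //.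
Qed.

Lemma is_derive_delta1P u (x y d : R) :
  is_derive (pt x y) (delta_mx 0 1) u d <-> is_derive y 1 (fun s => u (pt x s)) d.
Proof.
rewrite delta_mx1.
have E : (fun t : R => t^-1 *: (u (pt x (t *: 1 + y)) - u (pt x y))) =
         (fun t : R => t^-1 *: (u (t *: pt 0 1 + pt x y) - u (pt x y))).
  by apply/funext => t; rewrite ptZD mulr0 add0r.
split=> -[/= H1 H2]; split; move: H1 H2; rewrite /derivable /derive /= E //.
Qed.

Lemma is_derive_partial0 u (x y : R) : derivable u (pt x y) (delta_mx 0 0) ->
  is_derive x 1 (fun s => u (pt s y)) (partial 0 u (pt x y)).
Proof. by move=> H; apply/is_derive_delta0P/derivableP. Qed.

Lemma is_derive_partial1 u (x y : R) : derivable u (pt x y) (delta_mx 0 1) ->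
  is_derive y 1 (fun s => u (pt x s)) (partial 1 u (pt x y)).
Proof. by move=> H; apply/is_derive_delta1P/derivableP. Qed.

(** * Classes of differentiability and the chain rule *)

Lemma C_on_continuous n k (U : set 'rV[R]_n) (u : 'rV[R]_n -> R) (x : 'rV[R]_n) :
  C_on k U u -> U x -> {for x, continuous u}.
Proof. by case: k => [|k] /=; [apply | case=> + _; apply]. Qed.

Lemma C_on_derivable n k (U : set 'rV[R]_n) (u : 'rV[R]_n -> R) i (x : 'rV[R]_n) :
  C_on k.+1 U u -> U x -> derivable u x (delta_mx 0 i).
Proof. by case=> _ /(_ i)[+ _]; apply. Qed.

Lemma C_on_partial n k (U : set 'rV[R]_n) (u : 'rV[R]_n -> R) i :
  C_on k.+1 U u -> C_on k U (partial i u).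
Proof. by case=> _ /(_ i)[]. Qed.

Lemma C_onW n k (U : set 'rV[R]_n) (u : 'rV[R]_n -> R) :
  C_on k.+1 U u -> C_on k U u.
Proof.
elim: k u => [|k IH] u; first by case.
move=> [cu H]; split=> // i; split; first by have [] := H i.
by apply: IH; have [] := H i.
Qed.

Lemma eq_C_on n k (U : set 'rV[R]_n) (u v : 'rV[R]_n -> R) : open U ->
  (forall x, U x -> u x = v x) -> C_on k U u -> C_on k U v.
Proof.
move=> oU.
have uv_near (u1 v1 : 'rV[R]_n -> R) : (forall x, U x -> u1 x = v1 x) ->
    forall x, U x -> \near x, u1 x = v1 x.
  by move=> uv x Ux; apply: filterS (open_nbhs_nbhs (conj oU Ux)) => z /uv.
have cv (u1 v1 : 'rV[R]_n -> R) : (forall x, U x -> u1 x = v1 x) ->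
    (forall x, U x -> {for x, continuous u1}) ->
    forall x, U x -> {for x, continuous v1}.
  move=> uv cu x Ux; rewrite /prop_for /continuous_at -uv //.
  apply: cvg_trans (cu x Ux); apply: near_eq_cvg.
    exact: (nbhs_filter x).
  exact: uv_near.
elim: k u v => [|k IH] u v uv; first exact: cv.
move=> [cu H]; split; first exact: cv cu.
move=> i; have [H1 H2] := H i; split.
  by move=> x Ux; apply: near_eq_derivable (uv_near _ _ uv x Ux) (H1 x Ux).
by apply: IH H2 => x Ux; rewrite /partial; apply: near_eq_derive; exact: uv_near.
Qed.

Lemma C_onD n k (U : set 'rV[R]_n) (u v : 'rV[R]_n -> R) : open U ->
  C_on k U u -> C_on k U v -> C_on k U (fun x => u x + v x).
Proof.
move=> oU; elim: k u v => [|k IH] u v.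
  by move=> cu cv x Ux; apply: continuous_at_add; [apply: cu | apply: cv].
move=> [cu Hu] [cv Hv]; split.
  by move=> x Ux; apply: continuous_at_add; [apply: cu | apply: cv].
move=> i; have [H1 H2] := Hu i; have [H3 H4] := Hv i; split.
  by move=> x Ux; apply: derivableD; [apply: H1 | apply: H3].
apply: eq_C_on (IH _ _ H2 H4) => // x Ux.
by rewrite /partial deriveD //; [apply: H1 | apply: H3].
Qed.

Lemma C_on_laplacian k U u : open U -> C_on k.+2 U u -> C_on k U (laplacian u).
Proof.
move=> oU Cu.
have -> : laplacian u = fun x => partial 0 (partial 0 u) x + partial 1 (partial 1 u) x.
  by apply/funext => x; rewrite /laplacian sum_ord2.
by apply: C_onD => //; do 2 apply: C_on_partial.
Qed.

Lemma C_on1_of_partials U u (u0 u1 : 'rV[R]_2 -> R) : open U ->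
  (forall p, U p -> {for p, continuous u}) ->
  (forall p, U p -> {for p, continuous u0}) ->
  (forall p, U p -> {for p, continuous u1}) ->
  (forall x y : R, U (pt x y) -> is_derive x 1 (fun s => u (pt s y)) (u0 (pt x y))) ->
  (forall x y : R, U (pt x y) -> is_derive y 1 (fun s => u (pt x s)) (u1 (pt x y))) ->
  C_on 1 U u.
Proof.
move=> oU cu cu0 cu1 d0 d1.
have D0 p : U p -> is_derive p (delta_mx 0 0) u (u0 p).
  by rewrite (ptE p) => Up; apply/is_derive_delta0P/d0.
have D1 p : U p -> is_derive p (delta_mx 0 1) u (u1 p).
  by rewrite (ptE p) => Up; apply/is_derive_delta1P/d1.
split=> //; apply: ord2_ind; split.
- by move=> p /D0 [].
- by apply: (@eq_C_on 2 0 U u0) => // p /D0 [_ <-].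
- by move=> p /D1 [].
- by apply: (@eq_C_on 2 0 U u1) => // p /D1 [_ <-].
Qed.

(** [C_on 1] supplies partial derivatives, not a total differential. The increment splits into a
    vertical part, handled by the one-variable chain rule, and a horizontal part [q], which is [r]
    times the increment of [X]; the mean value theorem and continuity of [partial 0 u] make [r]
    continuous at [s]. *)
Lemma is_derive_chain U u (X Y : R -> R) s (X' Y' : R) : open U ->
  C_on 1 U u -> U (pt (X s) (Y s)) ->
  is_derive s 1 X X' -> is_derive s 1 Y Y' ->
  is_derive s 1 (fun t => u (pt (X t) (Y t)))
    (partial 0 u (pt (X s) (Y s)) * X' + partial 1 u (pt (X s) (Y s)) * Y').
Proof.
move=> oU Cu Up dX dY.
set p := pt (X s) (Y s); set u0 := partial 0 u p.
have /is_derive1_caratheodory[gX [XE cX gXs]] := dX.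
pose q t := u (pt (X t) (Y t)) - u (pt (X s) (Y t)).
pose r t := if X t == X s then u0 else q t / (X t - X s).
have qE t : q t = r t * (X t - X s).
  rewrite /r /q; case: eqP => [->|/eqP]; first by rewrite !subrr mulr0.
  by rewrite -subr_eq0 => /divfK->.
have cr : {for s, continuous r}.
  apply/cvgrPdist_lt => e e0; rewrite [r s]/r eqxx.
  have cu0 : {for p, continuous (partial 0 u)}.
    exact: C_on_continuous (C_on_partial 0 Cu) Up.
  have /cvgrPdist_lt /(_ _ e0) Hu0 := cu0.
  have [d /= d0 Hd] := (nbhs_ballP _ _).1
    (filterI (open_nbhs_nbhs (conj oU Up)) Hu0).
  have cXs := is_derive_continuous dX; have cYs := is_derive_continuous dY.
  have := cYs _ (nbhsx_ballx (Y s) d d0); have := cXs _ (nbhsx_ballx (X s) d d0).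
  rewrite !near_simpl; apply: filterS2 => t HX HY.
  rewrite /r; case: eqVneq => [_|Xts]; first by rewrite subrr normr0.
  have HB z : `|z - X s| <= `|X t - X s| -> ball p d (pt z (Y t)).
    move=> zX; apply/ball_pt; rewrite !mxE /=; split=> //.
    by rewrite /ball /= distrC (le_lt_trans zX) // distrC.
  have [|c cX' E] := @is_derive_mean_value_dist R (fun z => u (pt z (Y t)))
      (fun z => partial 0 u (pt z (Y t))) (X s) (X t).
    move=> z /HB zB; apply: is_derive_partial0; apply: C_on_derivable Cu _.
    exact: (Hd _ zB).1.
  rewrite /q E mulfK ?subr_eq0 //.
  exact: (Hd _ (HB c cX')).2.
have dq : is_derive s 1 q (u0 * X').
  apply/is_derive1_caratheodory; exists (fun t => r t * gX t); split.
  - by move=> z; rewrite qE [q s]/q subrr subr0 XE mulrA.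
  - exact: cvgM cr cX.
  - by rewrite /r eqxx gXs.
have du1 : is_derive s 1 (fun t => u (pt (X s) (Y t))) (partial 1 u p * Y').
  apply: (@is_derive1_comp R (fun y => u (pt (X s) y)) Y) dY.
  by apply: is_derive_partial1; apply: C_on_derivable Cu _.
have -> : (fun t => u (pt (X t) (Y t))) = q + (fun t => u (pt (X s) (Y t))).
  by apply/funext => t; rewrite /q /= /GRing.add /= subrK.
exact: is_deriveD.
Qed.

End Plane.

(** * Circular integrals *)

Section CircularIntegral.
Context {R : realType}.
Implicit Types (x y r s a : R) (U : set 'rV[R]_2) (h : 'rV[R]_2 -> R).

Definition cpt x y r a : 'rV[R]_2 := pt (x + r * cos a) (y + r * sin a).

(** Not normalised: the circular mean times [2 pi]. *)
Definition circ h x y r := segint 0 (pi *+ 2) (fun a => h (cpt x y r a)).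

Definition circ_normal h x y r := segint 0 (pi *+ 2) (fun a =>
  partial 0 h (cpt x y r a) * cos a + partial 1 h (cpt x y r a) * sin a).

Lemma pi2_ge0 : 0 <= pi *+ 2 :> R.
Proof. by rewrite mulrn_wge0 // pi_ge0. Qed.

Lemma pi2_gt0 : 0 < pi *+ 2 :> R.
Proof. by rewrite mulrn_wgt0 // pi_gt0. Qed.

Lemma cpt_2pi x y r : cpt x y r (pi *+ 2) = cpt x y r 0.
Proof. by rewrite /cpt cos2pi sin2pi cos0 sin0. Qed.

Lemma continuous_cpt (T : topologicalType) (X Y P A : T -> R) (t : T) :
  {for t, continuous X} -> {for t, continuous Y} ->
  {for t, continuous P} -> {for t, continuous A} ->
  {for t, continuous (fun z => cpt (X z) (Y z) (P z) (A z))}.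
Proof.
move=> cX cY cP cA; apply: continuous_pt; apply: continuous_at_add => //.
- apply: continuous_at_mul => //; apply: (@continuous_comp _ _ _ A cos) => //.
  exact: continuous_cos.
- apply: continuous_at_mul => //; apply: (@continuous_comp _ _ _ A sin) => //.
  exact: continuous_sin.
Qed.

Lemma continuous_on_cpt (T : topologicalType) k U h (X Y P A : T -> R) (t : T) :
  C_on k U h -> U (cpt (X t) (Y t) (P t) (A t)) ->
  {for t, continuous X} -> {for t, continuous Y} ->
  {for t, continuous P} -> {for t, continuous A} ->
  {for t, continuous (fun z => h (cpt (X z) (Y z) (P z) (A z)))}.
Proof.
move=> Ch Ut cX cY cP cA.
apply: (@continuous_comp _ _ _ (fun z => cpt (X z) (Y z) (P z) (A z)) h).
- exact: continuous_cpt.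
- exact: C_on_continuous Ch Ut.
Qed.

Lemma continuous_circle k U h x y r : C_on k U h ->
  (forall a, U (cpt x y r a)) -> continuous (fun a => h (cpt x y r a)).
Proof.
move=> Ch Ur a.
apply: (@continuous_on_cpt _ _ _ _ (fun=> x) (fun=> y) (fun=> r) id _ Ch) => //.
all: exact: continuous_at_cst || exact: cvg_id.
Qed.

Lemma is_derive_circ U h (X Y P : R -> R) (X' Y' P' s : R) : open U ->
  C_on 1 U h -> (\forall t \near s, forall a, U (cpt (X t) (Y t) (P t) a)) ->
  (\forall t \near s, is_derive (t : R) 1 X X') ->
  (\forall t \near s, is_derive (t : R) 1 Y Y') ->
  (\forall t \near s, is_derive (t : R) 1 P P') ->
  is_derive s 1 (fun t => circ h (X t) (Y t) (P t))
    (segint 0 (pi *+ 2) (fun a =>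
       partial 0 h (cpt (X s) (Y s) (P s) a) * (X' + P' * cos a) +
       partial 1 h (cpt (X s) (Y s) (P s) a) * (Y' + P' * sin a))).
Proof.
move=> oU Ch HU HX HY HP.
have Us := nbhs_singleton HU.
have ccos : continuous (fun a : R => cos a) := @continuous_cos R.
have csin : continuous (fun a : R => sin a) := @continuous_sin R.
have cu0 := continuous_circle (C_on_partial 0 Ch) Us.
have cu1 := continuous_circle (C_on_partial 1 Ch) Us.
apply: (@is_derive_segint R (fun t a => h (cpt (X t) (Y t) (P t) a))
  (fun t a => partial 0 h (cpt (X t) (Y t) (P t) a) * (X' + P' * cos a) +
              partial 1 h (cpt (X t) (Y t) (P t) a) * (Y' + P' * sin a))).
- exact: pi2_ge0.
- by apply: filterS HU => t Ut; apply: continuous_circle Ch Ut.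
- move=> a /=; by continuity.
- near=> t => a _.
  have dX : is_derive t 1 X X' by near: t.
  have dY : is_derive t 1 Y Y' by near: t.
  have dP : is_derive t 1 P P' by near: t.
  have Ut : forall a, U (cpt (X t) (Y t) (P t) a) by near: t.
  apply: (@is_derive_chain R U h (fun t => X t + P t * cos a)
    (fun t => Y t + P t * sin a)) => //; first exact: Ut.
  + by apply: is_derive_eq; rewrite /GRing.scale /=; ring.
  + by apply: is_derive_eq; rewrite /GRing.scale /=; ring.
- move=> a _.
  have c1 : {for (s, a), continuous (fun z : R * R => z.1)} by exact: cvg_fst.
  have c2 : {for (s, a), continuous (fun z : R * R => z.2)} by exact: cvg_snd.
  have cX : {for (s, a), continuous (fun z : R * R => X z.1)}.
    apply: (@continuous_comp _ _ _ fst X) => //.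
    exact: is_derive_continuous (nbhs_singleton HX).
  have cY : {for (s, a), continuous (fun z : R * R => Y z.1)}.
    apply: (@continuous_comp _ _ _ fst Y) => //.
    exact: is_derive_continuous (nbhs_singleton HY).
  have cP : {for (s, a), continuous (fun z : R * R => P z.1)}.
    apply: (@continuous_comp _ _ _ fst P) => //.
    exact: is_derive_continuous (nbhs_singleton HP).
  have cc : {for (s, a), continuous (fun z : R * R => cos z.2)}.
    by apply: (@continuous_comp _ _ _ (fun z : R * R => z.2) (fun b => cos b)) => //; exact: ccos.
  have cs : {for (s, a), continuous (fun z : R * R => sin z.2)}.
    by apply: (@continuous_comp _ _ _ (fun z : R * R => z.2) (fun b => sin b)) => //; exact: csin.
  have c0 := continuous_on_cpt (C_on_partial 0 Ch) (Us a) cX cY cP c2.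
  have c1' := continuous_on_cpt (C_on_partial 1 Ch) (Us a) cX cY cP c2.
  by continuity.
Unshelve. all: by end_near. Qed.

Lemma is_derive_circ_radius U h x y r : open U -> C_on 1 U h ->
  (\forall s \near r, forall a, U (cpt x y s a)) ->
  is_derive r 1 (circ h x y) (circ_normal h x y r).
Proof.
move=> oU Ch HU.
have := @is_derive_circ U h (fun=> x) (fun=> y) id 0 0 1 r oU Ch HU.
have -> : segint 0 (pi *+ 2) (fun a =>
       partial 0 h (cpt x y r a) * (0 + 1 * cos a) +
       partial 1 h (cpt x y r a) * (0 + 1 * sin a)) = circ_normal h x y r.
  by apply: eq_segint => a _; rewrite !add0r !mul1r.
apply; apply: (@filterE _ _ (nbhs_filter r)) => t.
- exact: is_derive_cst.
- exact: is_derive_cst.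
- exact: is_derive_id.
Qed.

Lemma is_derive_radial_product (f0 f1 : R -> R) (g0 g1 c e s : R) :
  is_derive s 1 f0 g0 -> is_derive s 1 f1 g1 ->
  is_derive s 1 (fun t => t * (f0 t * c + f1 t * e))
    ((f0 s * c + f1 s * e) + s * (g0 * c + g1 * e)).
Proof.
by move=> d0 d1; apply: is_derive_eq; rewrite /GRing.scale /=; ring.
Qed.

Lemma is_derive_rotation_product (f0 f1 : R -> R) (g0 g1 s : R) :
  is_derive s 1 f0 g0 -> is_derive s 1 f1 g1 ->
  is_derive s 1 (fun t => f1 t * cos t - f0 t * sin t)
    (g1 * cos s - g0 * sin s - (f0 s * cos s + f1 s * sin s)).
Proof.
by move=> d0 d1; apply: is_derive_eq; rewrite /GRing.scale /=; ring.
Qed.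

(** The divergence theorem on circles. The [s]-derivative of the integrand is [r] times the
    Laplacian minus [w], the angular derivative of the tangential component [W] of the gradient; [W]
    is periodic, so [w] integrates to zero. The mixed partials cancel term by term, without appeal
    to their symmetry. *)
Lemma is_derive_circ_laplacian U h x y r : open U -> C_on 2 U h ->
  (\forall s \near r, forall a, U (cpt x y s a)) ->
  is_derive r 1 (fun s => s * circ_normal h x y s) (r * circ (laplacian h) x y r).
Proof.
move=> oU Ch HU.
have Ur := nbhs_singleton HU.
have ccos : continuous (fun a : R => cos a) := @continuous_cos R.
have csin : continuous (fun a : R => sin a) := @continuous_sin R.
have C0 := C_on_partial 0 Ch; have C1 := C_on_partial 1 Ch.
pose k s a := s * (partial 0 h (cpt x y s a) * cos a + partial 1 h (cpt x y s a) * sin a).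
pose k' s a :=
  (partial 0 h (cpt x y s a) * cos a + partial 1 h (cpt x y s a) * sin a) +
  s * ((partial 0 (partial 0 h) (cpt x y s a) * cos a +
        partial 1 (partial 0 h) (cpt x y s a) * sin a) * cos a +
       (partial 0 (partial 1 h) (cpt x y s a) * cos a +
        partial 1 (partial 1 h) (cpt x y s a) * sin a) * sin a).
have ck' : forall s a, U (cpt x y s a) ->
    {for (s, a), continuous (fun z : R * R => k' z.1 z.2)}.
  move=> s a Us.
  have c1 : {for (s, a), continuous (fun z : R * R => z.1)} by exact: cvg_fst.
  have c2 : {for (s, a), continuous (fun z : R * R => z.2)} by exact: cvg_snd.
  have cc : {for (s, a), continuous (fun z : R * R => cos z.2)}.
    by apply: (@continuous_comp _ _ _ (fun z : R * R => z.2) (fun b => cos b)) => //; exact: ccos.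
  have cs : {for (s, a), continuous (fun z : R * R => sin z.2)}.
    by apply: (@continuous_comp _ _ _ (fun z : R * R => z.2) (fun b => sin b)) => //; exact: csin.
  have cu n u : C_on n U u ->
      {for (s, a), continuous (fun z : R * R => u (cpt x y z.1 z.2))}.
    move=> Cu; apply: (@continuous_on_cpt _ n U u (fun=> x) (fun=> y) fst snd) => //.
    - exact: continuous_at_cst.
    - exact: continuous_at_cst.
  have c0 := cu _ _ C0; have c1' := cu _ _ C1.
  have c00 := cu _ _ (C_on_partial 0 C0); have c01 := cu _ _ (C_on_partial 1 C0).
  have c10 := cu _ _ (C_on_partial 0 C1); have c11 := cu _ _ (C_on_partial 1 C1).
  have ct (f0 f1 f00 f01 f10 f11 : R * R -> R) (z0 : R * R) :
    continuous_at z0 (fun z : R * R => z.1) ->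
    continuous_at z0 (fun z => cos z.2) -> continuous_at z0 (fun z => sin z.2) ->
    continuous_at z0 f0 -> continuous_at z0 f1 -> continuous_at z0 f00 ->
    continuous_at z0 f01 -> continuous_at z0 f10 -> continuous_at z0 f11 ->
    continuous_at z0 (fun z => (f0 z * cos z.2 + f1 z * sin z.2) +
      z.1 * ((f00 z * cos z.2 + f01 z * sin z.2) * cos z.2 +
             (f10 z * cos z.2 + f11 z * sin z.2) * sin z.2)).
    by move=> *; continuity.
  pose p z := cpt x y z.1 z.2.
  exact: (ct (fun z => partial 0 h (p z)) (fun z => partial 1 h (p z))
    (fun z => partial 0 (partial 0 h) (p z)) (fun z => partial 1 (partial 0 h) (p z))
    (fun z => partial 0 (partial 1 h) (p z)) (fun z => partial 1 (partial 1 h) (p z))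
    (s, a) c1 cc cs c0 c1' c00 c01 c10 c11).
have ck s : (forall a, U (cpt x y s a)) -> continuous (k s).
  have ct (f0 f1 : R -> R) : continuous f0 -> continuous f1 ->
    continuous (fun a => s * (f0 a * cos a + f1 a * sin a)).
    by move=> c0 c1 a; continuity.
  by move=> Us; apply: ct; [exact: continuous_circle C0 Us | exact: continuous_circle C1 Us].
have ck'r : continuous (k' r).
  move=> a; apply: (@continuous_comp _ _ _ (fun a => (r, a)) (fun z => k' z.1 z.2)).
    apply: (@cvg_pair _ _ _ (nbhs a) (nbhs r) (nbhs a) _ _ _ (fun=> r) id).
    - exact: cvg_cst.
    - exact: cvg_id.
  exact: ck'.
have dk : is_derive r 1 (fun s => segint 0 (pi *+ 2) (k s)) (segint 0 (pi *+ 2) (k' r)).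
  apply: is_derive_segint => //.
  - exact: pi2_ge0.
  - exact: filterS HU.
  - apply: filterS HU => s Us a _.
    have dX : is_derive s 1 (fun t => x + t * cos a) (cos a).
      by apply: is_derive_eq; rewrite /GRing.scale /=; ring.
    have dY : is_derive s 1 (fun t => y + t * sin a) (sin a).
      by apply: is_derive_eq; rewrite /GRing.scale /=; ring.
    have d0 := @is_derive_chain R U (partial 0 h) (fun t => x + t * cos a)
      (fun t => y + t * sin a) s _ _ oU C0 (Us a) dX dY.
    have d1 := @is_derive_chain R U (partial 1 h) (fun t => x + t * cos a)
      (fun t => y + t * sin a) s _ _ oU C1 (Us a) dX dY.
  
    exact: is_derive_radial_product d0 d1.
  - by move=> a _; apply: ck'; apply: Ur.
pose w a :=
  (partial 0 (partial 1 h) (cpt x y r a) * - (r * sin a) +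
   partial 1 (partial 1 h) (cpt x y r a) * (r * cos a)) * cos a -
  (partial 0 (partial 0 h) (cpt x y r a) * - (r * sin a) +
   partial 1 (partial 0 h) (cpt x y r a) * (r * cos a)) * sin a -
  (partial 0 h (cpt x y r a) * cos a + partial 1 h (cpt x y r a) * sin a).
pose W a := partial 1 h (cpt x y r a) * cos a - partial 0 h (cpt x y r a) * sin a.
have clap : continuous (fun a => laplacian h (cpt x y r a)).
  by apply: (@continuous_circle 0 U) => //; exact: C_on_laplacian.
have kw a : k' r a = r * laplacian h (cpt x y r a) - w a.
  rewrite /k' /w /laplacian sum_ord2.
  set u00 := partial 0 (partial 0 h) _; set u11 := partial 1 (partial 1 h) _.
  set u01 := partial 1 (partial 0 h) _; set u10 := partial 0 (partial 1 h) _.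
  set u0 := partial 0 h _; set u1 := partial 1 h _.
  move: u00 u01 u10 u11 u0 u1 => u00 u01 u10 u11 u0 u1.
  rewrite -[in RHS](mulr1 (u00 + u11)) -(cos2Dsin2 a); ring.
have cw : continuous w.
  have -> : w = fun a => r * laplacian h (cpt x y r a) - k' r a.
    by apply/funext => a; rewrite kw opprB addrC subrK.
  by move=> a; continuity.
have dW a : is_derive a 1 W (w a).
  have dX : is_derive a 1 (fun t => x + r * cos t) (- (r * sin a)).
    by apply: is_derive_eq; rewrite /GRing.scale /=; ring.
  have dY : is_derive a 1 (fun t => y + r * sin t) (r * cos a).
    by apply: is_derive_eq; rewrite /GRing.scale /=; ring.
  have d0 := @is_derive_chain R U (partial 0 h) (fun t => x + r * cos t)
    (fun t => y + r * sin t) a _ _ oU C0 (Ur a) dX dY.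
  have d1 := @is_derive_chain R U (partial 1 h) (fun t => x + r * cos t)
    (fun t => y + r * sin t) a _ _ oU C1 (Ur a) dX dY.
  rewrite -/(cpt x y r a) in d0 d1.
  exact: is_derive_rotation_product d0 d1.
have := dk.
have -> : segint 0 (pi *+ 2) (k' r) = r * circ (laplacian h) x y r.
  rewrite -segintZ // (eq_segint (g := fun a => r * laplacian h (cpt x y r a) - w a)) //.
  rewrite segintB //; last by move=> a; continuity.
  rewrite (segint_derive pi2_gt0 cw dW) /W cpt_2pi cos2pi sin2pi cos0 sin0.
  by rewrite subrr subr0.
apply: near_eq_is_derive; apply: filterS HU => s Us.
rewrite -segintZ //.
have ct (f0 f1 : R -> R) : continuous f0 -> continuous f1 ->
  continuous (fun a => f0 a * cos a + f1 a * sin a).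
  by move=> c0 c1 a; continuity.
by apply: ct; [exact: continuous_circle C0 Us | exact: continuous_circle C1 Us].
Qed.

End CircularIntegral.

(** * Mean value inequality *)

Section MeanValue.
Context {R : realType}.
Implicit Types (x y r s a : R) (U : set 'rV[R]_2) (v F : 'rV[R]_2 -> R).

Lemma near_norm_lt (d s : R) (P : R -> Prop) : `|s| < d ->
  (forall t, `|t| < d -> P t) -> \forall t \near s, P t.
Proof.
move=> sd HP; apply/nbhs_ballP; exists (d - `|s|) => /=; first by rewrite subr_gt0.
move=> t; rewrite /ball /= => st; apply: HP.
have := ler_normD (t - s) s; rewrite subrK distrC; lra.
Qed.

Lemma circ_radius0 v x y : circ v x y 0 = v (pt x y) * (pi *+ 2).
Proof.
rewrite /circ (eq_segint (g := fun=> v (pt x y))) ?segint_cst ?subr0 //.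
  exact: pi2_ge0.
by move=> a _; rewrite /cpt !mul0r !addr0.
Qed.

Lemma circ_normal_radius0 v x y : circ_normal v x y 0 = 0.
Proof.
rewrite /circ_normal.
set u0 := partial 0 v (pt x y); set u1 := partial 1 v (pt x y).
rewrite (eq_segint (g := fun a => u0 * cos a + u1 * sin a)); last first.
  by move=> a _; rewrite /cpt !mul0r !addr0.
have cw : continuous (fun a : R => u0 * cos a + u1 * sin a).
  have ccos : continuous (fun a : R => cos a) := @continuous_cos R.
  have csin : continuous (fun a : R => sin a) := @continuous_sin R.
  by move=> a; continuity.
have dW a : is_derive a 1 (fun a => u0 * sin a - u1 * cos a) (u0 * cos a + u1 * sin a).
  by apply: is_derive_eq; rewrite /GRing.scale /=; ring.
by rewrite (segint_derive pi2_gt0 cw dW) cos2pi sin2pi cos0 sin0 subrr.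
Qed.

Lemma circ_le U v (w : 'rV[R]_2 -> R) x y r k l : C_on k U v -> C_on l U w ->
  (forall a, U (cpt x y r a)) -> (forall p, U p -> v p <= w p) ->
  circ v x y r <= circ w x y r.
Proof.
move=> Cv Cw Ur vw; apply: segint_le.
- exact: continuous_circle Cv Ur.
- exact: continuous_circle Cw Ur.
- by move=> a _; apply: vw.
Qed.

Lemma C_on_cst0 U : C_on 0 U (fun _ : 'rV[R]_2 => 0 : R).
Proof. by move=> p _; exact: continuous_at_cst. Qed.

Lemma circ_cst0 x y r : circ (fun=> 0) x y r = 0 :> R.
Proof. by rewrite /circ segint_cst ?mul0r //; exact: pi2_ge0. Qed.

(* [(A s - A 0) / s ^ 2] is nonincreasing because [B <= 0]; compare its values
   at [r] and [2 r]. *)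
Lemma radial_mean_value_ineq (A D Z DZ B : R -> R) (r : R) : 0 < r ->
  (forall s, 0 <= s <= 2 * r -> is_derive s 1 A (D s)) ->
  (forall s, 0 <= s <= 2 * r -> is_derive s 1 (fun t => t * D t) (s * Z s)) ->
  (forall s, 0 <= s <= 2 * r -> is_derive s 1 Z (DZ s)) ->
  (forall s, 0 <= s <= 2 * r -> is_derive s 1 (fun t => t * DZ t) (s * B s)) ->
  (forall s, 0 <= s <= 2 * r -> B s <= 0) ->
  D 0 = 0 -> 0 <= A (2 * r) -> 3 * A 0 <= 4 * A r.
Proof.
move=> r0 dA dD dZ dDZ B_le0 D0 A2.
have DZ_le0 s : 0 < s <= 2 * r -> DZ s <= 0.
  move=> sr.
  have := @is_derive_le R (fun t => t * DZ t) (fun t => t * B t) 0 s 0.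
  rewrite !mul0r !subr0 pmulr_rle0; last lra.
  apply.
  + lra.
  + by move=> t ?; apply: dDZ; lra.
  + by move=> t ?; apply: mulr_ge0_le0; [lra | apply: B_le0; lra].
have DZ_le s : 0 <= s <= 2 * r -> s ^+ 2 * DZ s <= 0.
  move=> sr; have [->|s0] := eqVneq s 0; first by rewrite expr0n /= mul0r.
  by apply: mulr_ge0_le0; [rewrite sqr_ge0 | apply: DZ_le0; lra].
have sq (s : R) : is_derive s 1 (fun t : R => t ^+ 2) (2 * s).
  by apply: is_derive_eq; rewrite /GRing.scale /=; ring.
(* [Z] is nonincreasing, so integrating [(t D t)' = t Z t >= t Z s] from 0 to [s] gives half of
   [s^2 Z s]. *)
have D_ge s : 0 <= s <= 2 * r -> s ^+ 2 * Z s <= 2 * (s * D s).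
  move=> sr.
  have := @is_derive_ge R (fun t => t * D t - 2^-1 * (t ^+ 2 * Z t))
            (fun t => t * Z t - 2^-1 * (t ^+ 2 * DZ t + Z t * (2 * t))) 0 s 0.
  rewrite /= !mul0r expr0n /= !mul0r mulr0 !subr0 => H.
  suff : 0 <= s * D s - 2^-1 * (s ^+ 2 * Z s) by lra.
  apply: H; first lra.
  + move=> t tr; apply: is_derive_lincomb; first by apply: dD; lra.
    have dZt : is_derive t 1 Z (DZ t) by apply: dZ; lra.
    by apply: is_derive_eq; rewrite /GRing.scale /=; ring.
  + move=> t tr; have h : t ^+ 2 * DZ t <= 0 by apply: DZ_le; lra.
    lra.
(* Divided by [s^3], this is the derivative of [(A s - A 0) / s^2]; its own derivative [s Z - 2 D]
   is nonpositive away from 0 by [D_ge]. *)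
have N_le0 s : 0 <= s <= 2 * r -> s * D s - 2 * (A s - A 0) <= 0.
  move=> sr.
  have := @is_derive_le R (fun t => t * D t - 2 * (A t - A 0))
            (fun t => t * Z t - 2 * D t) 0 s 0.
  rewrite /= !mul0r subrr mulr0 !subr0; apply; first lra.
  + move=> t tr; apply: is_derive_lincomb; first by apply: dD; lra.
    have dAt : is_derive t 1 A (D t) by apply: dA; lra.
    by apply: is_derive_eq; rewrite oppr0 addr0.
  + move=> t tr; have [->|t0] := eqVneq t 0.
      by rewrite mul0r D0; lra.
    have {}t0 : 0 < t by lra.
    rewrite -(ler_pM2l t0) mulr0.
    have h : t ^+ 2 * Z t <= 2 * (t * D t) by apply: D_ge; lra.
    lra.
have dY s : r <= s <= 2 * r -> is_derive s 1 (fun t => (A t - A 0) * (t ^+ 2)^-1)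
    (s * D s * s ^- 3 - 2 * (A s - A 0) * s ^- 3).
  move=> sr; have s0 : s != 0 by lra.
  have dsq : is_derive s 1 (fun t : R => (t ^+ 2)^-1) (- (s ^+ 2) ^- 2 *: (2 * s)).
    by apply: is_deriveV; rewrite sqrf_eq0.
  have dA' : is_derive s 1 (fun t => A t - A 0) (D s).
    have dAs : is_derive s 1 A (D s) by apply: dA; lra.
    by apply: is_derive_eq; rewrite oppr0 addr0.
  by apply: is_derive_eq; rewrite /GRing.scale /=; field.
have := @is_derive_le R _ _ r (2 * r) 0 _ dY.
rewrite mul0r; have r2 : r <= 2 * r by lra.
move=> /(_ r2).
have h : forall s, r <= s <= 2 * r -> s * D s * s ^- 3 - 2 * (A s - A 0) * s ^- 3 <= 0.
  move=> s sr; rewrite -mulrBl; apply: mulr_le0_ge0; first by apply: N_le0; lra.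
  by rewrite invr_ge0 exprn_ge0 //; lra.
move=> /(_ h).
rewrite exprMn invfM mulrA -mulrBl pmulr_lle0; last by rewrite invr_gt0 exprn_gt0.
(* The comparison reads [(A (2r) - A 0) / 4 <= A r - A 0]; then [A (2r) >= 0] is dropped. *)
have -> : (2 : R) ^- 2 = 4^-1 by congr (_^-1); ring.
lra.
Qed.

Lemma circ_mean_value_ineq U v x y r d : open U -> C_on 4 U v ->
  (forall p, U p -> 0 <= v p) -> (forall p, U p -> bilaplacian v p <= 0) ->
  0 < r -> 2 * r < d -> (forall s a, `|s| < d -> U (cpt x y s a)) ->
  3 * (v (pt x y) * (pi *+ 2)) <= 4 * circ v x y r.
Proof.
move=> oU Cv v0 Bv r0 rd Ud.
have s2 s : 0 <= s <= 2 * r -> `|s| < d by move=> ?; rewrite ger0_norm; lra.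
have Un s : 0 <= s <= 2 * r -> \forall t \near s, forall a, U (cpt x y t a).
  by move=> /s2 sd; apply: near_norm_lt sd _ => t td a; apply: Ud.
have U2 s : 0 <= s <= 2 * r -> forall a, U (cpt x y s a).
  by move=> /s2 sd a; apply: Ud.
have CL : C_on 2 U (laplacian v) by apply: C_on_laplacian.
rewrite -circ_radius0.
apply: (@radial_mean_value_ineq (circ v x y) (circ_normal v x y)
  (circ (laplacian v) x y) (circ_normal (laplacian v) x y)
  (circ (bilaplacian v) x y)) => // [s sr|s sr|s sr|s sr|s sr||].
- exact: is_derive_circ_radius oU (C_onW (C_onW (C_onW Cv))) (Un s sr).
- exact: is_derive_circ_laplacian oU (C_onW (C_onW Cv)) (Un s sr).
- exact: is_derive_circ_radius oU (C_onW CL) (Un s sr).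
- exact: is_derive_circ_laplacian oU CL (Un s sr).
- rewrite -(circ_cst0 x y s).
  exact: (circ_le (C_on_laplacian oU CL) (@C_on_cst0 U) (U2 s sr)).
- exact: circ_normal_radius0.
- rewrite -(circ_cst0 x y (2 * r)).
  by apply: (circ_le (@C_on_cst0 U) Cv) => //; apply: U2; lra.
Qed.

End MeanValue.

(** * Recentring disc integrals *)

Section Translation.
Context {R : realType}.
Implicit Types (x y p q r s a : R) (F : 'rV[R]_2 -> R).

Let ccos : continuous (fun a : R => cos a) := @continuous_cos R.
Let csin : continuous (fun a : R => sin a) := @continuous_sin R.

Lemma is_derive_flux_radial (f g : R -> R) (f' c s : R) :
  is_derive s 1 f f' ->
  is_derive s 1 (fun t => t * (f t * c)) (f s * c + s * (f' * c)).
Proof. by move=> df; apply: is_derive_eq; rewrite /GRing.scale /=; ring. Qed.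

Lemma is_derive_flux_angular (f : R -> R) (f' x y s : R) : is_derive s 1 f f' ->
  is_derive s 1 (fun t => f t * (x * sin t - y * cos t))
    (f s * (x * cos s + y * sin s) + f' * (x * sin s - y * cos s)).
Proof. by move=> df; apply: is_derive_eq; rewrite /GRing.scale /=; ring. Qed.

(** The flux of the vector field [F (x, y)], of constant direction, out of a circle. *)
Definition circ_flux F x y p q r := segint 0 (pi *+ 2) (fun a =>
  r * (F (cpt p q r a) * (x * cos a + y * sin a))).

Definition circ_dir F x y p q r := segint 0 (pi *+ 2) (fun a =>
  partial 0 F (cpt p q r a) * x + partial 1 F (cpt p q r a) * y).

(** The divergence of that field is the derivative of [F] along [(x, y)]; the rest of the integrand
    is again the angular derivative of a periodic [W]. *)
Lemma is_derive_circ_flux F x y p q r : C_on 1 setT F ->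
  is_derive r 1 (circ_flux F x y p q) (r * circ_dir F x y p q r).
Proof.
move=> CF.
have C0 := C_on_partial 0 CF; have C1 := C_on_partial 1 CF.
have oT : open [set: 'rV[R]_2] by exact: openT.
pose c a := x * cos a + y * sin a.
have cc : continuous c by move=> a; rewrite /c; continuity.
pose k s a := s * (F (cpt p q s a) * c a).
pose k' s a := F (cpt p q s a) * c a +
  s * ((partial 0 F (cpt p q s a) * cos a + partial 1 F (cpt p q s a) * sin a) * c a).
have ck' s a : {for (s, a), continuous (fun z : R * R => k' z.1 z.2)}.
  have c1 : {for (s, a), continuous (fun z : R * R => z.1)} by exact: cvg_fst.
  have c2 : {for (s, a), continuous (fun z : R * R => z.2)} by exact: cvg_snd.
  have comp2 (f : R -> R) : continuous f ->
      {for (s, a), continuous (fun z : R * R => f z.2)}.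
    by move=> cf; apply: (@continuous_comp _ _ _ (fun z : R * R => z.2) f) => //; exact: cf.
  have cu n u : C_on n setT u ->
      {for (s, a), continuous (fun z : R * R => u (cpt p q z.1 z.2))}.
    move=> Cu; apply: (@continuous_on_cpt _ _ n setT u (fun=> p) (fun=> q) fst snd) => //.
    - exact: continuous_at_cst.
    - exact: continuous_at_cst.
  have ct (f f0 f1 : R * R -> R) (z0 : R * R) :
    continuous_at z0 (fun z : R * R => z.1) ->
    continuous_at z0 (fun z => cos z.2) -> continuous_at z0 (fun z => sin z.2) ->
    continuous_at z0 (fun z => c z.2) ->
    continuous_at z0 f -> continuous_at z0 f0 -> continuous_at z0 f1 ->
    continuous_at z0 (fun z => f z * c z.2 +
      z.1 * ((f0 z * cos z.2 + f1 z * sin z.2) * c z.2)).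
    by move=> *; continuity.
  pose P z := cpt p q z.1 z.2.
  exact: (ct (fun z => F (P z)) (fun z => partial 0 F (P z)) (fun z => partial 1 F (P z))
    (s, a) c1 (comp2 _ ccos) (comp2 _ csin) (comp2 _ cc)
    (cu _ _ CF) (cu _ _ C0) (cu _ _ C1)).
have ck s : continuous (k s).
  have ct (f0 : R -> R) : continuous f0 -> continuous (fun a => s * (f0 a * c a)).
    by move=> c0 a; continuity.
  by apply: ct; apply: continuous_circle CF _.
have ck'r : continuous (k' r).
  move=> a; apply: (@continuous_comp _ _ _ (fun a => (r, a)) (fun z => k' z.1 z.2)).
    apply: (@cvg_pair _ _ _ (nbhs a) (nbhs r) (nbhs a) _ _ _ (fun=> r) id).
    - exact: cvg_cst.
    - exact: cvg_id.
  exact: ck'.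
have dk : is_derive r 1 (fun s => segint 0 (pi *+ 2) (k s)) (segint 0 (pi *+ 2) (k' r)).
  apply: is_derive_segint => //.
  - exact: pi2_ge0.
  - exact: filterE.
  - apply: filterE => s a _.
    have dX : is_derive s 1 (fun t => p + t * cos a) (cos a).
      by apply: is_derive_eq; rewrite /GRing.scale /=; ring.
    have dY : is_derive s 1 (fun t => q + t * sin a) (sin a).
      by apply: is_derive_eq; rewrite /GRing.scale /=; ring.
    have d0 := @is_derive_chain R setT F (fun t => p + t * cos a)
      (fun t => q + t * sin a) s _ _ oT CF I dX dY.
    exact: is_derive_flux_radial d0.
pose w a := F (cpt p q r a) * c a +
  (partial 0 F (cpt p q r a) * - (r * sin a) +
   partial 1 F (cpt p q r a) * (r * cos a)) * (x * sin a - y * cos a).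
pose W a := F (cpt p q r a) * (x * sin a - y * cos a).
pose dirF a := partial 0 F (cpt p q r a) * x + partial 1 F (cpt p q r a) * y.
have cdir : continuous dirF.
  have ct (f0 f1 : R -> R) : continuous f0 -> continuous f1 ->
      continuous (fun a => f0 a * x + f1 a * y).
    by move=> c0 c1 a; continuity.
  by apply: ct; [apply: continuous_circle C0 _ | apply: continuous_circle C1 _].
have kw a : k' r a = r * dirF a + w a.
  rewrite /k' /w /dirF /c.
  set u0 := partial 0 F _; set u1 := partial 1 F _; set u := F _.
  move: u u0 u1 => u u0 u1.
  rewrite -[X in r * X + _]mulr1 -(cos2Dsin2 a); ring.
have cw : continuous w.
  have -> : w = fun a => k' r a - r * dirF a.
    by apply/funext => a; rewrite kw addrC addKr.
  by move=> a; continuity.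
have dW a : is_derive a 1 W (w a).
  have dX : is_derive a 1 (fun t => p + r * cos t) (- (r * sin a)).
    by apply: is_derive_eq; rewrite /GRing.scale /=; ring.
  have dY : is_derive a 1 (fun t => q + r * sin t) (r * cos a).
    by apply: is_derive_eq; rewrite /GRing.scale /=; ring.
  have d0 := @is_derive_chain R setT F (fun t => p + r * cos t)
    (fun t => q + r * sin t) a _ _ oT CF I dX dY.
  exact: is_derive_flux_angular d0.
have -> : r * circ_dir F x y p q r = segint 0 (pi *+ 2) (k' r).
  rewrite -segintZ // [RHS](eq_segint (g := fun a => r * dirF a + w a)) //.
  rewrite segintD //; last by move=> a; continuity.
  rewrite (segint_derive pi2_gt0 cw dW) /W cpt_2pi cos2pi sin2pi cos0 sin0.
  by rewrite subrr addr0.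
exact: dk.
Qed.

(* Translation invariance of Lebesgue measure in polar coordinates: the
   derivative in the position of the center is a divergence. *)
Lemma disc_integral_translation F x y (M : R) : 0 < M -> C_on 1 setT F ->
  (forall s a, 0 <= s <= 1 -> F (cpt (s * x) (s * y) M a) = 0) ->
  segint 0 M (fun r => r * circ F x y r) = segint 0 M (fun r => r * circ F 0 0 r).
Proof.
move=> M0 CF FM.
have C0 := C_on_partial 0 CF; have C1 := C_on_partial 1 CF.
have oT : open [set: 'rV[R]_2] by exact: openT.
have cF p q : continuous (fun r => r * circ F p q r).
  move=> r; have cC : {for r, continuous (circ F p q)}.
    apply: is_derive_continuous.
    by apply: (@is_derive_circ_radius R setT F p q r oT CF); apply: filterE.
  have ct (g : R -> R) : continuous_at r g -> continuous_at r (fun t => t * g t).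
    by move=> cg; continuity.
  exact: ct cC.
pose G s r := circ_dir F x y (s * x) (s * y) r.
have cGj (z0 : R * R) : {for z0, continuous (fun z : R * R => G z.1 z.2)}.
  apply: (@continuous_segint R (R * R)%type (fun z a =>
    partial 0 F (cpt (z.1 * x) (z.1 * y) z.2 a) * x +
    partial 1 F (cpt (z.1 * x) (z.1 * y) z.2 a) * y)); first exact: pi2_ge0.
  - move=> a _; set w0 := (z0, a).
    have c1 : {for w0, continuous (fun w : (R * R) * R => w.1.1)}.
      by apply: continuous_comp; [exact: cvg_fst | exact: cvg_fst].
    have c2 : {for w0, continuous (fun w : (R * R) * R => w.1.2)}.
      by apply: continuous_comp; [exact: cvg_fst | exact: cvg_snd].
    have c3 : {for w0, continuous (fun w : (R * R) * R => w.2)} by exact: cvg_snd.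
    have cX : {for w0, continuous (fun w : (R * R) * R => w.1.1 * x)} by continuity.
    have cY : {for w0, continuous (fun w : (R * R) * R => w.1.1 * y)} by continuity.
    have cu n u : C_on n setT u -> {for w0, continuous
        (fun w : (R * R) * R => u (cpt (w.1.1 * x) (w.1.1 * y) w.1.2 w.2))}.
      by move=> Cu; apply: (@continuous_on_cpt R _ n setT u) => //.
    have ct (f0 f1 : (R * R) * R -> R) : continuous_at w0 f0 -> continuous_at w0 f1 ->
      continuous_at w0 (fun w => f0 w * x + f1 w * y).
      by move=> *; continuity.
    pose P (w : (R * R) * R) := cpt (w.1.1 * x) (w.1.1 * y) w.1.2 w.2.
    exact: (ct (fun w => partial 0 F (P w)) (fun w => partial 1 F (P w))
      (cu _ _ C0) (cu _ _ C1)).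
  - apply: filterE => z.
    have ct (f0 f1 : R -> R) : continuous f0 -> continuous f1 ->
        continuous (fun a => f0 a * x + f1 a * y).
      by move=> c0 c1 a; continuity.
    by apply: ct; [apply: continuous_circle C0 _ | apply: continuous_circle C1 _].
have cG s r : {for (s, r), continuous (fun z : R * R => z.2 * G z.1 z.2)}.
  have c2 : {for (s, r), continuous (fun z : R * R => z.2)} by exact: cvg_snd.
  have ct (g : R * R -> R) : continuous_at (s, r) g ->
    continuous_at (s, r) (fun z : R * R => z.2 * g z) by move=> cg; continuity.
  exact: (ct (fun z => G z.1 z.2) (cGj (s, r))).
have cGr s : continuous (fun r => r * G s r).
  move=> r; apply: (@continuous_comp _ _ _ (fun r => (s, r)) (fun z => z.2 * G z.1 z.2)).
    apply: (@cvg_pair _ _ _ (nbhs r) (nbhs s) (nbhs r) _ _ _ (fun=> s) id).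
    - exact: cvg_cst.
    - exact: cvg_id.
  exact: cG.
have dcirc s r : is_derive s 1 (fun t => circ F (t * x) (t * y) r) (G s r).
  have -> : G s r = segint 0 (pi *+ 2) (fun a =>
       partial 0 F (cpt (s * x) (s * y) r a) * (x + 0 * cos a) +
       partial 1 F (cpt (s * x) (s * y) r a) * (y + 0 * sin a)).
    by apply: eq_segint => a _; rewrite !mul0r !addr0.
  apply: (@is_derive_circ R setT F (fun t => t * x) (fun t => t * y) (fun=> r)
    x y 0 s oT CF).
  - exact: filterE.
  - by apply: filterE => t; apply: is_derive_eq; rewrite /GRing.scale /=; ring.
  - by apply: filterE => t; apply: is_derive_eq; rewrite /GRing.scale /=; ring.
  - by apply: filterE => t; exact: is_derive_cst.
have scale (f : R -> R) (f' c s : R) : is_derive s 1 f f' ->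
    is_derive s 1 (fun t => c * f t) (c * f').
  by move=> df; apply: is_derive_eq; rewrite /GRing.scale /=; ring.
pose J t := segint 0 M (fun r => r * circ F (t * x) (t * y) r).
have dJ s : is_derive s 1 J (segint 0 M (fun r => r * G s r)).
  apply: (@is_derive_segint R (fun t r => r * circ F (t * x) (t * y) r)
    (fun t r => r * G t r)); first exact: ltW.
  - by apply: filterE => t; exact: cF.
  - exact: cGr.
  - by apply: filterE => t r _; apply: scale (dcirc t r).
  - by move=> r _; exact: cG.
(* The integrand is the derivative of the flux, which vanishes at radius 0 by its factor [r] and at
   radius [M] because [F] does. *)
have J0 s : 0 <= s <= 1 -> segint 0 M (fun r => r * G s r) = 0.
  move=> s01.
  have dflux r := @is_derive_circ_flux F x y (s * x) (s * y) r CF.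
  rewrite (segint_derive M0 (cGr s) dflux) /circ_flux.
  rewrite (eq_segint (g := fun=> 0)); last first.
    by move=> a _; rewrite FM // mul0r mulr0.
  rewrite [X in _ - X](eq_segint (g := fun=> 0)); last by move=> a _; rewrite mul0r.
  by rewrite subrr.
have [c c01 E] := @is_derive_mean_value R J _ 0 1 ler01 (fun s _ => dJ s).
have EJ : J 1 = J 0 by apply/eqP; rewrite -subr_eq0 E J0 // mul0r.
have J1E : J 1 = segint 0 M (fun r => r * circ F x y r) by apply: eq_segint => r _; rewrite (mul1r x) (mul1r y).
have J0E : J 0 = segint 0 M (fun r => r * circ F 0 0 r) by apply: eq_segint => r _; rewrite (mul0r x) (mul0r y).
clear dJ E; clearbody J; by rewrite -J1E EJ J0E.
Qed.

End Translation.

(** * Cutoff functions *)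

Section Cutoff.
Context {R : realType}.
Implicit Types (x y r s a c z : R) (U : set 'rV[R]_2) (v : 'rV[R]_2 -> R).

(** Squaring makes the positive part C^1, enough for the recentring argument, and keeps the integral
    over a disc explicit. *)
Definition sqpos z : R := Num.max 0 z ^+ 2.

Lemma sqpos_le0 z : z <= 0 -> sqpos z = 0.
Proof. by move=> z0; rewrite /sqpos max_l // expr0n. Qed.

(** In each sign case the remainder is at most [(w - z)^2], so a ball of radius [e] suffices. *)
Lemma is_derive_sqpos z : is_derive z 1 sqpos (2 * Num.max 0 z).
Proof.
apply: is_derive_of_estimate => e e0; apply/nbhs_ballP; exists e => // w.
rewrite /ball /= distrC => wz.
apply: (@le_trans _ _ (`|w - z| * `|w - z|)); last by rewrite ler_wpM2r // ltW.
rewrite -normrM (ger0_norm (_ : 0 <= (w - z) * (w - z))) -?expr2 ?sqr_ge0 //.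
rewrite ler_norml /sqpos.
have hsq := sqr_ge0 (w - z); have hz := sqr_ge0 z; have hw := sqr_ge0 w.
by have [z0|z0] := leP 0 z; have [w0|w0] := leP 0 w; apply/andP; split;
  rewrite ?expr0n /=; nra.
Qed.

Lemma continuous_sqpos : continuous sqpos.
Proof. by move=> z; exact: is_derive_continuous (is_derive_sqpos z). Qed.

Lemma continuous_pos : continuous (fun z : R => Num.max 0 z).
Proof.
move=> z; apply/cvgrPdist_le => e e0; apply/nbhs_ballP; exists e => // w.
rewrite /ball /= => zw; apply: le_trans (ltW zw).
rewrite ler_norml.
have [z0|z0] := leP 0 z; have [w0|w0] := leP 0 w;
  have := ler_norm (z - w); have := ler_norm (w - z); rewrite (distrC w); lra.
Qed.

(** [c] is the square of the radius. *)
Definition disc_gap x y c (p : 'rV[R]_2) : R :=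
  c - ((p 0 0 - x) ^+ 2 + (p 0 1 - y) ^+ 2).

Lemma continuous_disc_gap x y c : continuous (disc_gap x y c).
Proof.
have c0 : continuous (fun p : 'rV[R]_2 => p 0 0) by exact: coord_continuous.
have c1 : continuous (fun p : 'rV[R]_2 => p 0 1) by exact: coord_continuous.
have -> : disc_gap x y c = fun p => c -
   ((p 0 0 - x) * (p 0 0 - x) + (p 0 1 - y) * (p 0 1 - y)).
  by apply/funext => p; rewrite /disc_gap !expr2.
by move=> p; continuity.
Qed.

(** [v] is arbitrary off [U], yet the product is C^1 on the whole plane: a point with nonnegative
    gap lies in [U], and near a point with negative gap the product vanishes identically. *)
Lemma C_on1_cutoff U v x y c : open U -> C_on 1 U v ->
  (forall p, 0 <= disc_gap x y c p -> U p) ->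
  C_on 1 setT (fun p => v p * sqpos (disc_gap x y c p)).
Proof.
move=> oU Cv HU; set g := disc_gap x y c.
have C0 := C_on_partial 0 Cv; have C1 := C_on_partial 1 Cv.
have cg : continuous g := @continuous_disc_gap x y c.
have g_near p : g p < 0 -> \forall q \near p, g q < 0.
  by move=> gp; exact: (cvgr_lt (g p) (cg p) 0 gp).
have glue (u : 'rV[R]_2 -> R) : (forall p, U p -> {for p, continuous u}) ->
    (forall p, g p < 0 -> u p = 0) -> forall p, {for p, continuous u}.
  move=> cu u0 p; have [gp|gp] := leP 0 (g p); first by apply: cu; apply: HU.
  have h0 : (fun _ : 'rV[R]_2 => 0 : R) @ p --> u p.
    by rewrite u0 //; exact: continuous_at_cst.
  apply: cvg_trans h0.
  apply: near_eq_cvg; first exact: (nbhs_filter p).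
  by apply: filterS (g_near p gp) => q /u0.
have csg : continuous (fun p => sqpos (g p)).
  by move=> p; apply: (@continuous_comp _ _ _ g sqpos); [exact: cg | exact: continuous_sqpos].
have cpg : continuous (fun p => Num.max 0 (g p)).
  by move=> p; apply: (@continuous_comp _ _ _ g (fun z => Num.max 0 z));
     [exact: cg | exact: continuous_pos].
have c0 : continuous (fun p : 'rV[R]_2 => p 0 0) by exact: coord_continuous.
have c1 : continuous (fun p : 'rV[R]_2 => p 0 1) by exact: coord_continuous.
have g0 p : g p < 0 -> sqpos (g p) = 0 by move=> gp; apply: sqpos_le0; apply: ltW.
have g0' p : g p < 0 -> Num.max 0 (g p) = 0 by move=> gp; rewrite max_l // ltW.
have ct (f f0 s0 m0 l0 : 'rV[R]_2 -> R) p :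
    continuous_at p f -> continuous_at p f0 ->
    continuous_at p s0 -> continuous_at p m0 -> continuous_at p l0 ->
    continuous_at p (fun q => f0 q * s0 q + f q * (2 * m0 q * l0 q)).
  by move=> *; continuity.
have cl0 (p : 'rV[R]_2) : continuous_at p (fun q : 'rV[R]_2 => -2 * (q 0 0 - x)).
  by continuity.
have cl1 (p : 'rV[R]_2) : continuous_at p (fun q : 'rV[R]_2 => -2 * (q 0 1 - y)).
  by continuity.
have dprod (f h : R -> R) (f' h' t : R) : is_derive t 1 f f' -> is_derive t 1 h h' ->
    is_derive t 1 (fun s => f s * sqpos (h s))
      (f' * sqpos (h t) + f t * (2 * Num.max 0 (h t) * h')).
  move=> df dh; have dsh := @is_derive1_comp R sqpos h t _ _ (is_derive_sqpos (h t)) dh.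
  by apply: is_derive_eq; rewrite /GRing.scale /=; ring.
apply: (@C_on1_of_partials R setT _
  (fun p => partial 0 v p * sqpos (g p) + v p * (2 * Num.max 0 (g p) * (-2 * (p 0 0 - x))))
  (fun p => partial 1 v p * sqpos (g p) + v p * (2 * Num.max 0 (g p) * (-2 * (p 0 1 - y)))))
  => //; first exact: openT.
- move=> p _; apply: glue => {}p; last by move=> /g0 ->; rewrite mulr0.
  move=> Up; apply: (@continuous_at_mul _ _ v); last exact: csg.
  exact: C_on_continuous Cv Up.
- move=> p _; apply: glue => {}p; last first.
    by move=> gp; rewrite g0 // g0' // !(mulr0, mul0r) addr0.
  move=> Up; apply: (ct v (partial 0 v)) => //.
  + exact: C_on_continuous Cv Up.
  + exact: C_on_continuous C0 Up.
- move=> p _; apply: glue => {}p; last first.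
    by move=> gp; rewrite g0 // g0' // !(mulr0, mul0r) addr0.
  move=> Up; apply: (ct v (partial 1 v)) => //.
  + exact: C_on_continuous Cv Up.
  + exact: C_on_continuous C1 Up.
- move=> x0 y0 _; have [gp|] := boolP (0 <= g (pt x0 y0)).
    have dv := is_derive_partial0 (C_on_derivable (i := 0) Cv (HU _ gp)).
    have dg : is_derive x0 1 (fun s => g (pt s y0)) (-2 * (pt x0 y0 0 0 - x)).
      rewrite pt0; have -> : (fun s => g (pt s y0)) =
          (fun s => c - ((s - x) ^+ 2 + (y0 - y) ^+ 2)).
        by apply/funext => s; rewrite /g /disc_gap pt0 pt1.
      by apply: is_derive_eq; rewrite /GRing.scale /=; ring.
    exact: (dprod (fun s => v (pt s y0)) (fun s => g (pt s y0)) _ _ x0 dv dg).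
  rewrite -ltNge => gp; rewrite g0 // g0' // !(mulr0, mul0r) addr0.
  have cx : {for x0, continuous (fun s => g (pt s y0))}.
    apply: (@continuous_comp _ _ _ (fun s => pt s y0) g); last exact: cg.
    by apply: continuous_pt; [exact: cvg_id | exact: cvg_cst].
  have ng : \forall s \near x0, g (pt s y0) < 0 by exact: (cvgr_lt _ cx 0 gp).
  apply: (@near_eq_is_derive _ _ _ (fun=> 0)).
  by apply: filterS ng => s gs; rewrite g0 // mulr0.
- move=> x0 y0 _; have [gp|] := boolP (0 <= g (pt x0 y0)).
    have dv := is_derive_partial1 (C_on_derivable (i := 1) Cv (HU _ gp)).
    have dg : is_derive y0 1 (fun s => g (pt x0 s)) (-2 * (pt x0 y0 0 1 - y)).
      rewrite pt1; have -> : (fun s => g (pt x0 s)) =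
          (fun s => c - ((x0 - x) ^+ 2 + (s - y) ^+ 2)).
        by apply/funext => s; rewrite /g /disc_gap pt0 pt1.
      by apply: is_derive_eq; rewrite /GRing.scale /=; ring.
    exact: (dprod (fun s => v (pt x0 s)) (fun s => g (pt x0 s)) _ _ y0 dv dg).
  rewrite -ltNge => gp; rewrite g0 // g0' // !(mulr0, mul0r) addr0.
  have cx : {for y0, continuous (fun s => g (pt x0 s))}.
    apply: (@continuous_comp _ _ _ (fun s => pt x0 s) g); last exact: cg.
    by apply: continuous_pt; [exact: cvg_cst | exact: cvg_id].
  have ng : \forall s \near y0, g (pt x0 s) < 0 by exact: (cvgr_lt _ cx 0 gp).
  apply: (@near_eq_is_derive _ _ _ (fun=> 0)).
  by apply: filterS ng => s gs; rewrite g0 // mulr0.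
Qed.

End Cutoff.

(** * Pointwise bound by circular integrals *)

Section PointwiseBound.
Context {R : realType}.
Implicit Types (x y r s a : R) (U : set 'rV[R]_2) (v : 'rV[R]_2 -> R).

Lemma norm_cos_sin_le x y r a : 0 <= r -> x ^+ 2 + y ^+ 2 = r ^+ 2 ->
  `|x * cos a + y * sin a| <= r.
Proof.
move=> r0 E; rewrite -(ler_pXn2r (n := 2)) ?nnegrE // -normrX ger0_norm ?sqr_ge0 //.
have := cos2Dsin2 a; have := sqr_ge0 (x * sin a - y * cos a).
move: (cos a) (sin a) => c s h cs; rewrite -E.
have -> : x ^+ 2 + y ^+ 2 = (x ^+ 2 + y ^+ 2) * (c ^+ 2 + s ^+ 2) by rewrite cs mulr1.
lra.
Qed.

Lemma cpt_sqnorm_ge x y r s a : 0 <= r -> x ^+ 2 + y ^+ 2 = r ^+ 2 ->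
  (r - `|s|) ^+ 2 <= (x + s * cos a) ^+ 2 + (y + s * sin a) ^+ 2.
Proof.
move=> r0 E; have := norm_cos_sin_le a r0 E; have := cos2Dsin2 a.
move: (cos a) (sin a) => c t cs h.
have -> : (x + s * c) ^+ 2 + (y + s * t) ^+ 2 =
   (x ^+ 2 + y ^+ 2) + s ^+ 2 * (c ^+ 2 + t ^+ 2) + 2 * (s * (x * c + y * t)) by ring.
rewrite cs mulr1 E -(real_normK (num_real s)).
have h2 : `|s * (x * c + y * t)| <= `|s| * r by rewrite normrM ler_wpM2l.
have := ler_norm (- (s * (x * c + y * t))); rewrite normrN; lra.
Qed.

Lemma circ_disc_gap x y c r a : disc_gap x y c (cpt x y r a) = c - r ^+ 2.
Proof.
have := cos2Dsin2 a; rewrite /disc_gap pt0 pt1.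
move: (cos a) (sin a) => ca sa E.
have -> : (x + r * ca - x) ^+ 2 + (y + r * sa - y) ^+ 2 = r ^+ 2 * (ca ^+ 2 + sa ^+ 2).
  by ring.
by rewrite E mulr1.
Qed.

Lemma continuous_mul_sqpos c : continuous (fun r : R => r * sqpos (c - r ^+ 2)).
Proof.
move=> r; have cq : continuous_at r (fun r => sqpos (c - r ^+ 2)).
  apply: (@continuous_comp _ _ _ (fun r => c - r ^+ 2) sqpos); last exact: continuous_sqpos.
  have -> : (fun r : R => c - r ^+ 2) = (fun r => c - r * r).
    by apply/funext => t; rewrite expr2.
  by continuity.
by continuity.
Qed.

Lemma segint_sqpos_disc (c M : R) : 0 < M -> c <= M ^+ 2 -> 0 <= c ->
  segint 0 M (fun r => r * sqpos (c - r ^+ 2)) = c ^+ 3 / 6.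
Proof.
move=> M0 cM c0.
(* This is [-1/6] times the cube of the positive part of [c - r^2], written so that
   [is_derive_sqpos] applies. *)
pose G (r : R) := - 6^-1 * ((c - r ^+ 2) * sqpos (c - r ^+ 2)).
have cf := @continuous_mul_sqpos c.
have dG (r : R) : is_derive r 1 G (r * sqpos (c - r ^+ 2)).
  have dh : is_derive r 1 (fun t : R => c - t ^+ 2) (- (2 * r)).
    by apply: is_derive_eq; rewrite /GRing.scale /=; ring.
  have dsh := @is_derive1_comp R sqpos (fun t => c - t ^+ 2) r _ _ (is_derive_sqpos _) dh.
  apply: is_derive_eq; rewrite /GRing.scale /= /sqpos.
  by have [z0|z0] := leP 0 (c - r ^+ 2); [field | rewrite expr0n /=; ring].
rewrite (segint_derive M0 cf dG) /G (@sqpos_le0 _ (c - M ^+ 2)) ?subr_le0 //.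
by rewrite !mulr0 expr0n /= subr0 /sqpos max_r //; field.
Qed.

(** The cutoff lives on the disc of radius [r / 4] around the point. The integral is bounded below
    circle by circle around the point, and above by monotonicity of [circ v 0 0], as the disc is at
    distance at least [3 r / 4] from the origin. The condition [2 * R0 < r] leaves room for the
    doubled circles. *)
Lemma pointwise_bound U v (R0 r th : R) : open U -> C_on 4 U v ->
  (forall p, U p -> 0 <= v p) -> (forall p, U p -> bilaplacian v p <= 0) ->
  0 <= R0 -> 2 * R0 < r ->
  (forall p : 'rV[R]_2, R0 ^+ 2 < p 0 0 ^+ 2 + p 0 1 ^+ 2 -> U p) ->
  (forall s t, r / 2 <= s -> s <= t -> circ v 0 0 s <= circ v 0 0 t) ->
  v (cpt 0 0 r th) <= 128 * circ v 0 0 (2 * r).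
Proof.
move=> oU Cv v_ge0 Bv R00 R0r HU mono.
have r0 : 0 < r by lra.
pose x := r * cos th; pose y := r * sin th.
have xyE : x ^+ 2 + y ^+ 2 = r ^+ 2.
  by rewrite /x /y !exprMn -mulrDr cos2Dsin2 mulr1.
have -> : cpt 0 0 r th = pt x y by rewrite /cpt !add0r.
clearbody x y.
pose c := (r / 4) ^+ 2; pose g := disc_gap x y c.
have cE : c = r ^+ 2 / 16 by rewrite /c; field.
pose F p := v p * sqpos (g p).
have sqlt (s t : R) : 0 <= s -> s < t -> s ^+ 2 < t ^+ 2 by move=> ? ?; nra.
have circ_in s a : `|s| < r - R0 -> U (cpt x y s a).
  move=> sr; apply: HU; rewrite pt0 pt1.
  apply: lt_le_trans (cpt_sqnorm_ge s a (ltW r0) xyE).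
  by apply: sqlt => //; lra.
have circ0_in s a : R0 < s -> U (cpt 0 0 s a).
  move=> sr; apply: HU; rewrite pt0 pt1 !add0r !exprMn -mulrDr cos2Dsin2 mulr1.
  exact: sqlt.
have gU p : 0 <= g p -> U p.
  move=> gp; apply: HU; move: gp; rewrite /g /disc_gap cE.
  move: (p 0 0) (p 0 1) => p0 p1 h.
  (* Expanding these squares gives [|p|^2 >= 9 r^2 / 16] on the disc. *)
  have h0 := sqr_ge0 (x / 2 + 2 * (p0 - x)); have h1 := sqr_ge0 (y / 2 + 2 * (p1 - y)).
  have h2 : R0 ^+ 2 < (r / 2) ^+ 2 by apply: sqlt => //; lra.
  have h3 : 0 < r ^+ 2 by rewrite exprn_gt0.
  nra.
have CF : C_on 1 setT F by apply: C_on1_cutoff oU (C_onW (C_onW (C_onW Cv))) gU.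
have g_le s t a : 0 <= t <= 1 -> 0 <= s ->
    g (cpt (t * x) (t * y) s a) <= c - (s - (1 - t) * r) ^+ 2.
  move=> t01 s0; rewrite /g /disc_gap pt0 pt1 lerD2l lerN2.
  have h : ((t - 1) * x) ^+ 2 + ((t - 1) * y) ^+ 2 = ((1 - t) * r) ^+ 2.
    by rewrite !exprMn -mulrDr xyE; ring.
  have h0 : 0 <= (1 - t) * r by apply: mulr_ge0; lra.
  have := cpt_sqnorm_ge s a h0 h; rewrite ger0_norm //.
  move: (cos a) (sin a) => ca sa H.
  rewrite (_ : t * x + s * ca - x = (t - 1) * x + s * ca); last ring.
  rewrite (_ : t * y + s * sa - y = (t - 1) * y + s * sa); last ring.
  by apply: le_trans H; rewrite -[leLHS]sqrrN opprB.
(* Radius [2 r] keeps the cutoff disc inside the disc around every intermediate centre. *)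
have FM t a : 0 <= t <= 1 -> F (cpt (t * x) (t * y) (2 * r) a) = 0.
  move=> t01; rewrite /F sqpos_le0 ?mulr0 //.
  apply: le_trans (g_le _ _ _ t01 _) _; first lra.
  by rewrite /c subr_le0; nra.
have vx : 0 <= v (pt x y).
  by apply: v_ge0; apply: HU; rewrite pt0 pt1 xyE; apply: sqlt => //; lra.
have M0 : 0 < 2 * r by lra.
have := @disc_integral_translation R F x y (2 * r) M0 CF FM.
have cJ p q : continuous (fun s => s * circ F p q s).
  move=> s; have cC : {for s, continuous (circ F p q)}.
    apply: is_derive_continuous.
    apply: (@is_derive_circ_radius R setT F p q s (@openT _) CF); exact: filterE.
  have ct (h : R -> R) : continuous_at s h -> continuous_at s (fun t => t * h t).
    by move=> cg; continuity.
  exact: ct cC.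
have c0 : 0 < c by rewrite cE divr_gt0 ?exprn_gt0.
have lower : 3 / 4 * (v (pt x y) * (pi *+ 2)) * (c ^+ 3 / 6) <=
    segint 0 (2 * r) (fun s => s * circ F x y s).
  set K := 3 / 4 * _.
  have cq : continuous (fun s : R => s * sqpos (c - s ^+ 2)) := @continuous_mul_sqpos c.
  rewrite -(@segint_sqpos_disc c (2 * r)) //; [|by rewrite /c; nra|exact: ltW].
  rewrite -segintZ //; apply: segint_le => //.
    have ct (h : R -> R) : continuous h -> continuous (fun s => K * h s).
      by move=> ch s; continuity.
    exact: ct cq.
  move=> s sr; have FE a : F (cpt x y s a) = sqpos (c - s ^+ 2) * v (cpt x y s a).
    by rewrite /F /g circ_disc_gap mulrC.
  have [s4|s4] := leP (r / 4) s.
    rewrite sqpos_le0 ?mulr0; last by rewrite /c; nra.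
    rewrite /circ (eq_segint (g := fun=> 0)); last first.
      by move=> a _; rewrite FE sqpos_le0 ?mul0r // /c; nra.
    by rewrite segint_cst ?mul0r ?mulr0 //; exact: pi2_ge0.
  have [->|s0] := eqVneq s 0; first by rewrite !mul0r mulr0.
  have Us a : U (cpt x y s a) by apply: circ_in; rewrite ger0_norm; lra.
  have -> : circ F x y s = sqpos (c - s ^+ 2) * circ v x y s.
    rewrite -segintZ; last exact: continuous_circle Cv Us.
    by apply: eq_segint => a _; rewrite FE.
  have := @circ_mean_value_ineq R U v x y s (r - R0) oU Cv v_ge0 Bv.
  move=> /(_ _ _ circ_in) H.
  have {}H : 3 * (v (pt x y) * (pi *+ 2)) <= 4 * circ v x y s by apply: H; lra.
  have h : K <= circ v x y s by rewrite /K; lra.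
  rewrite mulrCA; apply: ler_wpM2l; first lra.
  by rewrite mulrC; apply: ler_wpM2l => //; rewrite sqr_ge0.
have V0 : 0 <= circ v 0 0 (2 * r).
  rewrite -[leLHS](circ_cst0 0 0 (2 * r)); apply: (circ_le (@C_on_cst0 R U) Cv) => // a.
  by apply: circ0_in; lra.
have upper : segint 0 (2 * r) (fun s => s * circ F 0 0 s) <=
    4 * r ^+ 2 * (c ^+ 2 * circ v 0 0 (2 * r)).
  have -> : 4 * r ^+ 2 * (c ^+ 2 * circ v 0 0 (2 * r)) =
      segint 0 (2 * r) (fun=> 2 * r * (c ^+ 2 * circ v 0 0 (2 * r))).
    by rewrite segint_cst ?subr0; [ring | lra].
  apply: segint_le => // [s|s sr]; first exact: continuous_at_cst.
  have h : circ F 0 0 s <= c ^+ 2 * circ v 0 0 (2 * r).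
    have [s4|s4] := leP (3 / 4 * r) s; last first.
      rewrite /circ (eq_segint (g := fun=> 0)); last first.
        move=> a _; rewrite /F sqpos_le0 ?mulr0 //.
        have := g_le s 0 a; rewrite !mul0r subr0 mul1r => H.
        apply: le_trans (H _ _) _; [lra|lra|rewrite /c; nra].
      rewrite segint_cst ?mul0r; last exact: pi2_ge0.
      by rewrite mulr_ge0 ?sqr_ge0.
    have Us a : U (cpt 0 0 s a) by apply: circ0_in; lra.
    apply: (@le_trans _ _ (c ^+ 2 * circ v 0 0 s)); last first.
      by rewrite ler_wpM2l ?sqr_ge0 //; apply: mono; lra.
    rewrite -segintZ; last exact: continuous_circle Cv Us.
    apply: segint_le.
    - by apply: (continuous_circle CF).
    - have ct (h : R -> R) : continuous h -> continuous (fun s => c ^+ 2 * h s).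
        by move=> ch t; continuity.
      by apply: ct; exact: continuous_circle Cv Us.
    - move=> a _; rewrite /F mulrC ler_wpM2r //; first exact: v_ge0.
      have gc : g (cpt 0 0 s a) <= c by rewrite /g /disc_gap gerBl addr_ge0 ?sqr_ge0.
      rewrite /sqpos ler_pXn2r ?nnegrE ?ge_max ?le_max ?lexx //; first by rewrite ltW.
      exact: ltW.
  apply: (@le_trans _ _ (s * (c ^+ 2 * circ v 0 0 (2 * r)))).
    by apply: ler_wpM2l => //; lra.
  by apply: ler_wpM2r; [rewrite mulr_ge0 ?sqr_ge0 | lra].
(* As [r^2 = 16 c], dividing by [c^3] leaves [v (pi / 4) <= 64 circ v 0 0 (2 r)], and [pi >= 2]
   turns [256 / pi] into 128. *)
move=> E; move: lower; rewrite E => /le_trans /(_ upper).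
have c3 : 0 < c ^+ 3 by rewrite exprn_gt0.
have -> : 4 * r ^+ 2 * (c ^+ 2 * circ v 0 0 (2 * r)) = c ^+ 3 * (64 * circ v 0 0 (2 * r)).
  by rewrite cE; field.
have -> : 3 / 4 * (v (pt x y) * (pi *+ 2)) * (c ^+ 3 / 6) = c ^+ 3 * (v (pt x y) * (pi / 4)).
  by field.
rewrite (ler_pM2l c3).
move: (pi_ge2 R) vx; move: (v (pt x y)) (circ v 0 0 (2 * r)) (pi : R).
by clear=> w V p p2 w0; nra.
Qed.

End PointwiseBound.

(** * The nonlinearity *)

Section Nonlinearity.
Context {R : realType}.
Implicit Types (s b e B : R) (f : R -> R).

Lemma iter_ln_gt i B : exists M : R, forall s, M < s -> B < iter_ln i s.
Proof.
elim: i B => [|i IH] B; first by exists B.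
have [M HM] := IH (expR B); exists M => s /HM h.
rewrite /iter_ln iterS -/(iter_ln i s) -(expRK B) ltr_ln ?posrE ?expR_gt0 //.
by apply: lt_trans h; exact: expR_gt0.
Qed.

Lemma iter_ln_gt1 k : exists M : R, forall s, M < s ->
  forall i, (i <= k)%N -> 1 < iter_ln i s.
Proof.
elim: k => [|k [M HM]].
  by have [M HM] := iter_ln_gt 0 1; exists M => s /HM h [|[]].
have [M' HM'] := iter_ln_gt k.+1 1; exists (Num.max M M') => s.
rewrite gt_max => /andP[/HM h /HM' h'] i.
by rewrite leq_eqVlt => /predU1P[->//|]; apply: h.
Qed.

Lemma iter_ln_le_iter_ln2 k s : (forall i, (i <= k)%N -> 1 < iter_ln i s) ->
  forall i, (2 <= i <= k)%N -> iter_ln i s <= iter_ln 2 s.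
Proof.
move=> H; elim=> [//|i IH] /andP[i2 ik].
move: i2; rewrite leq_eqVlt => /predU1P[<-//|i2].
have ii : 1 < iter_ln i s by apply: H; apply: ltnW.
apply: le_trans (IH _); last by rewrite -ltnS i2 ltnW.
by rewrite {1}/iter_ln iterS -/(iter_ln i s); apply: ltW; apply: ln_sublinear; lra.
Qed.

Lemma pow_le_exp n b : 0 < b -> exists C : R, 0 < C /\
  forall y : R, 0 <= y -> y ^+ n <= C * expR (b * y).
Proof.
move=> b0; case: n => [|n].
  exists 1; split=> // y y0; rewrite expr0 mul1r -[leLHS]expR0 ler_expR.
  by apply: mulr_ge0 => //; exact: ltW.
have n0 : 0 < n.+1%:R :> R by rewrite ltr0n.
(* This is [z <= e^z] at [z = b y / n.+1], raised to the power [n.+1]. *)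
exists ((n.+1%:R / b) ^+ n.+1); split; first by rewrite exprn_gt0 // divr_gt0.
move=> y y0.
have -> : b * y = n.+1%:R * (b * y / n.+1%:R) by field; rewrite gt_eqF //.
rewrite expRM_natl -exprMn ler_pXn2r ?nnegrE //; last first.
  by rewrite mulr_ge0 ?expR_ge0 // divr_ge0 // ltW.
rewrite -ler_pdivrMl ?divr_gt0 //; apply: le_trans (_ : b * y / n.+1%:R <= _).
  by rewrite invf_div mulrAC.
by apply: le_trans (expR_ge1Dx _); rewrite lerDr.
Qed.

(** With [y = ln (ln s)] the quotient is at most [y^(k.+1 - 2) / e^(b y)], because each factor is at
    most [iter_ln 2 s]. *)
Lemma prod_iter_ln_le k b : 0 < b -> exists C M : R, 0 < C /\
  forall s, M < s -> (\prod_(2 <= i < k.+1) iter_ln i s) / ln s `^ b <= C.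
Proof.
move=> b0; have [C [C0 HC]] := pow_le_exp (k.+1 - 2) b0.
(* [maxn k 2] controls [iter_ln 2 s] even when the product is empty. *)
have [M HM] := iter_ln_gt1 (maxn k 2).
exists C, M; split=> // s /HM H.
have l1 : 1 < ln s by have := H 1%N; apply; rewrite leq_max orbT.
have l2 : 1 < iter_ln 2 s by apply: H; rewrite leq_max orbT.
have l0 : 0 < ln s by lra.
rewrite ler_pdivrMr ?powR_gt0 //.
have -> : ln s `^ b = expR (b * iter_ln 2 s).
  by rewrite mulrC expRM /iter_ln /= lnK.
apply: le_trans (HC _ _); last lra.
rewrite -prodr_const_nat big_nat [leRHS]big_nat; apply: ler_prod => i /andP[i2 ik].
have h := @iter_ln_le_iter_ln2 (maxn k 2) s H i.
have ik' : (i <= maxn k 2)%N by rewrite leq_max -ltnS ik.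
have := H i ik'; rewrite h ?i2 //; lra.
Qed.

Lemma liminf_gt0_lower_bound f b k : 0 < b -> (forall s, 0 < s -> 0 < f s) ->
  (0 < limf_einf (fun s : R =>
        ((f s / s `^ (- b)) *
         ((\prod_(2 <= i < k.+1) iter_ln i s) / ln s `^ b))%:E)
        (+oo%R : set_system R))%E ->
  exists e S : R, 0 < e /\ forall s, S < s -> e * s `^ (- b) <= f s.
Proof.
move=> b0 f0; rewrite limf_einfE => /ereal_sup_gt[_ /= [A [M [_ MA]] <-]] y0.
(* The lower limit is a supremum of infima over sets of the filter, so some [A] has a positive
   infimum; if that is [+oo], no real value is attained on [A] and the bound is vacuous. *)
have [e [e0 He]] : exists e : R, 0 < e /\ forall s, A s -> e <=
    (f s / s `^ (- b)) * ((\prod_(2 <= i < k.+1) iter_ln i s) / ln s `^ b).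
  move: y0; set E := ereal_inf _ => E0.
  have HE s : A s -> (E <= ((f s / s `^ (- b)) *
      ((\prod_(2 <= i < k.+1) iter_ln i s) / ln s `^ b))%:E)%E.
    by move=> As; apply: ereal_inf_lbound; exists s.
  clearbody E; case: E E0 HE => [e|| ] e0 HE.
  - by exists e; split; [rewrite -lte_fin | move=> s /HE; rewrite lee_fin].
  - by exists 1; split=> // s /HE; rewrite leye_eq.
  - by move: e0; rewrite ltNge leNye.
have [C [M' [C0 HC]]] := @prod_iter_ln_le k b b0.
exists (e / C), (Num.max 0 (Num.max M M')); split; first exact: divr_gt0.
move=> s; rewrite !gt_max => /and3P[s0 /MA /He h /HC h'].
have p0 : 0 < s `^ (- b) by apply: powR_gt0.
have q0 : 0 < f s / s `^ (- b) by apply: divr_gt0 => //; exact: f0.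
rewrite -ler_pdivlMr // ler_pdivrMr //; apply: le_trans h _.
by apply: ler_wpM2l => //; exact: ltW.
Qed.

Lemma powRN_anti b x y : 0 <= b -> 0 < x -> x <= y -> y `^ (- b) <= x `^ (- b).
Proof.
move=> b0 x0 xy; have y0 : 0 < y by apply: lt_le_trans xy.
rewrite !powRN lef_pV2 ?posrE ?powR_gt0 //.
by apply: ge0_ler_powR => //; rewrite nnegrE ltW.
Qed.

(** Between [c] and [S] compactness gives [f] a positive minimum, and the factor [c^b] absorbs
    [s^(-b) <= c^(-b)]. *)
Lemma lower_bound_on_ray f b (e S c : R) : 0 <= b -> 0 < c -> 0 < e ->
  (forall s, 0 < s -> 0 < f s) -> {within `]0, +oo[, continuous f} ->
  (forall s, S < s -> e * s `^ (- b) <= f s) ->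
  exists e' : R, 0 < e' /\ forall s, c <= s -> e' * s `^ (- b) <= f s.
Proof.
move=> b0 c0 e0 f0 cf HS.
have cS : c <= Num.max c S by rewrite le_max lexx.
have [|m mcS Hm] := @EVT_min R f c (Num.max c S) cS.
  apply: continuous_subspaceW cf => x /=; rewrite !in_itv /= andbT => /andP[cx _].
  exact: lt_le_trans cx.
have m0 : 0 < f m.
  by apply: f0; move: mcS; rewrite in_itv /= => /andP[cm _]; apply: lt_le_trans cm.
have cb0 : 0 < c `^ b by apply: powR_gt0.
exists (Num.min e (f m * c `^ b)); split.
  by rewrite lt_min e0 mulr_gt0.
move=> s cs; have s0 : 0 < s by apply: lt_le_trans cs.
have [sS|Ss] := leP s (Num.max c S).
- have fm : f m <= f s by apply: Hm; rewrite in_itv /= cs.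
  apply: le_trans fm; apply: (@le_trans _ _ (f m * c `^ b * s `^ (- b))).
    by rewrite ler_wpM2r ?powR_ge0 // ge_min lexx orbT.
  rewrite -mulrA ger_pMr // powRN mulrC ler_pdivrMl ?powR_gt0 // mulr1.
  by apply: ge0_ler_powR => //; rewrite nnegrE ltW.
- apply: le_trans (HS s _); last by move: Ss; rewrite gt_max => /andP[].
  by rewrite ler_wpM2r ?powR_ge0 // ge_min lexx.
Qed.

End Nonlinearity.

(** * Exterior domains *)

Section ExteriorDomain.
Context {R : realType}.
Implicit Types (x y r s a t : R) (U : set 'rV[R]_2) (v : 'rV[R]_2 -> R).

Lemma enorm_pt x y : enorm (pt x y) = Num.sqrt (x ^+ 2 + y ^+ 2).
Proof. by rewrite /enorm sum_ord2 pt0 pt1. Qed.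

Lemma cpt0_sqnorm r a : cpt 0 0 r a 0 0 ^+ 2 + cpt 0 0 r a 0 1 ^+ 2 = r ^+ 2.
Proof. by rewrite pt0 pt1 !add0r !exprMn -mulrDr cos2Dsin2 mulr1. Qed.

Lemma enorm_cpt0 r a : 0 <= r -> enorm (cpt 0 0 r a) = r.
Proof.
move=> r0; rewrite /cpt enorm_pt !add0r !exprMn -mulrDr cos2Dsin2 mulr1.
by rewrite sqrtr_sqr ger0_norm.
Qed.

Lemma exterior_of_compact (Om : set 'rV[R]_2) : compact Om ->
  exists R0 : R, 0 <= R0 /\
    forall p : 'rV[R]_2, R0 ^+ 2 < p 0 0 ^+ 2 + p 0 1 ^+ 2 -> (~` Om) p.
Proof.
move=> /compact_bounded [M [_ HM]].
pose B := Num.max 0 M + 1.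
have B0 : 0 <= B by rewrite /B addr_ge0 // le_max lexx.
have MB : M < B by rewrite /B ltr_pwDr // le_max lexx orbT.
clearbody B.
(* [B] bounds the sup norm, and the Euclidean norm is at most [sqrt 2] times as large. *)
exists (2 * B); split; first by lra.
move=> p Hp Omp; have := HM B MB p Omp => nB.
have pB j : `|p 0 j| <= B.
  apply: le_trans nB; rewrite [leRHS]/Num.Def.normr /= mx_normrE.
  exact: (le_bigmax _ (fun ij : 'I_1 * 'I_2 => `|p ij.1 ij.2|) (0, j)).
have sq j : p 0 j ^+ 2 <= B ^+ 2.
  by rewrite -(real_normK (num_real _)) ler_pXn2r ?nnegrE.
have := sq 0; have := sq 1; have : 0 <= B ^+ 2 by rewrite sqr_ge0.
move: Hp; rewrite exprMn; lra.
Qed.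

Lemma circ_gt0 U v k x y r : C_on k U v -> (forall a, U (cpt x y r a)) ->
  (forall p, U p -> 0 < v p) -> 0 < circ v x y r.
Proof.
move=> Cv Ur v0; have cv := continuous_circle Cv Ur.
have [|m _ Hm] := @EVT_min R (fun a => v (cpt x y r a)) 0 (pi *+ 2) (@pi2_ge0 R).
  exact: continuous_subspaceT.
apply: (@lt_le_trans _ _ (v (cpt x y r m) * (pi *+ 2 - 0))).
  by rewrite subr0 mulr_gt0 ?pi2_gt0 // v0.
rewrite -(segint_cst _ (@pi2_ge0 R)); apply: segint_le.
- by move=> a; exact: continuous_at_cst.
- exact: cv.
- by move=> a ab; apply: Hm; rewrite in_itv.
Qed.

(** The line vanishes at [c] and stays below [e S^(-b)] up to [S], hence below the nonincreasing
    power; left of [c] it is negative and [0 <= y] suffices. Being affine, the bound can be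
    integrated over a circle. *)
Lemma linear_below_power (e b S c w y : R) : 0 <= b -> 0 < e -> 0 < c -> 0 <= y ->
  0 < w -> w <= S -> (c <= w -> e * w `^ (- b) <= y) ->
  e * S `^ (- b) / S * (w - c) <= y.
Proof.
move=> b0 e0 c0 y0 w0 wS Hw.
have S0 : 0 < S by apply: lt_le_trans wS.
have q0 : 0 <= e * S `^ (- b) by rewrite mulr_ge0 ?powR_ge0 // ltW.
have [cw|wc] := leP c w.
  apply: le_trans (Hw cw); apply: (@le_trans _ _ (e * S `^ (- b))).
    rewrite -mulrA -[leRHS]mulr1 ler_wpM2l // mulrC ler_pdivrMr // mul1r; lra.
  by rewrite ler_pM2l //; apply: powRN_anti.
apply: le_trans y0; apply: mulr_ge0_le0; last lra.
by rewrite divr_ge0 // ltW.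
Qed.

Lemma no_exterior_solution U v f (R0 b : R) : open U -> C_on 4 U v ->
  0 <= R0 -> (forall p : 'rV[R]_2, R0 ^+ 2 < p 0 0 ^+ 2 + p 0 1 ^+ 2 -> U p) ->
  (forall p, U p -> 0 < v p) -> 0 < b -> b <= 1 ->
  (forall s, 0 < s -> 0 < f s) ->
  (forall c, 0 < c -> exists e : R, 0 < e /\ forall s, c <= s -> e * s `^ (- b) <= f s) ->
  (forall p, U p -> enorm p `^ (- (2 - 2 * b)) * f (v p) <= - bilaplacian v p) ->
  False.
Proof.
move=> oU Cv R00 HU v0 b0 b1 f0 Hf ineq.
have v_ge0 p : U p -> 0 <= v p by move=> /v0 /ltW.
have Bv p : U p -> bilaplacian v p <= 0.
  move=> Up; rewrite -oppr_ge0; apply: le_trans (ineq p Up).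
  by rewrite mulr_ge0 ?powR_ge0 // ltW // f0 // v0.
have CL : C_on 2 U (laplacian v) by apply: C_on_laplacian.
have CB : C_on 0 U (bilaplacian v) by apply: C_on_laplacian.
have Ur r a : R0 < r -> U (cpt 0 0 r a).
  by move=> rR; apply: HU; rewrite cpt0_sqnorm; nra.
have Un r : R0 < r -> \forall s \near r, forall a, U (cpt 0 0 s a).
  move=> rR; apply/nbhs_ballP; exists (r - R0) => /=; first by rewrite subr_gt0.
  move=> s; rewrite /ball /= => rs a; apply: Ur.
  by have := ler_norm (r - s); lra.
(* Since [e^t >= 1 + t], beyond [T0] the radius exceeds [2 R0], as [pointwise_bound] requires. *)
pose T0 := 2 * R0 + 1.
have T01 : 1 <= T0 by rewrite /T0; lra.
have eT t : T0 < t -> 2 * R0 < expR t.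
  by rewrite /T0 => ?; have := expR_ge1Dx t; lra.
have eT' t : T0 < t -> R0 < expR t by move=> /eT ?; lra.
pose V t := circ v 0 0 (expR t).
pose V1 t := expR t * circ_normal v 0 0 (expR t).
pose Z t := circ (laplacian v) 0 0 (expR t).
pose Z1 t := expR t * circ_normal (laplacian v) 0 0 (expR t).
pose H t := - (expR (2 * t) * circ (bilaplacian v) 0 0 (expR t)).
have compE (g : R -> R) (g' t : R) : is_derive (expR t) 1 g g' ->
    is_derive t 1 (fun s => g (expR s)) (expR t * g').
  by move=> dg; rewrite mulrC; exact: (@is_derive1_comp R g expR t _ _ dg (is_derive_expR t)).
have e2 t : expR (2 * t) = expR t * expR t.
  by rewrite -expRD; congr expR; ring.
have dV t : T0 < t -> is_derive t 1 V (V1 t).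
  move=> /eT' /Un h.
  exact: (compE _ _ _ (is_derive_circ_radius oU (C_onW (C_onW (C_onW Cv))) h)).
have dV1 t : T0 < t -> is_derive t 1 V1 (expR (2 * t) * Z t).
  move=> /eT' /Un h; rewrite e2 -mulrA.
  exact: (compE (fun r => r * circ_normal v 0 0 r) _ _
    (is_derive_circ_laplacian oU (C_onW (C_onW Cv)) h)).
have dZ t : T0 < t -> is_derive t 1 Z (Z1 t).
  move=> /eT' /Un h.
  exact: (compE _ _ _ (is_derive_circ_radius oU (C_onW CL) h)).
have dZ1 t : T0 < t -> is_derive t 1 Z1 (- H t).
  move=> /eT' /Un h; rewrite /H opprK e2 -mulrA.
  exact: (compE (fun r => r * circ_normal (laplacian v) 0 0 r) _ _
    (is_derive_circ_laplacian oU CL h)).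
have H0 t : T0 < t -> 0 <= H t.
  move=> /eT' h; rewrite /H oppr_ge0; apply: mulr_ge0_le0; first exact: expR_ge0.
  rewrite -[leRHS](circ_cst0 0 0 (expR t)).
  by apply: (circ_le CB (@C_on_cst0 R U)) => // a; apply: Ur.
have V0 t : T0 < t -> 0 < V t.
  by move=> /eT' h; apply: (circ_gt0 Cv) => // a; apply: Ur.
have [C [TC [C1 TCT HC]]] := radial_growth T01 dV dV1 dZ dZ1 H0 V0.
have ln2 : 0 < ln (2 : R) by apply: ln_gt0; lra.
have [K [TK [K1 TKT V1_ge0 HK]]] :=
  radial_monotone_doubling T01 dV dV1 dZ dZ1 H0 V0 ln2.
have V_mono s t : TK < s -> s <= t -> V s <= V t.
  move=> sK st; have := @is_derive_ge R V V1 s t 0 st; rewrite mul0r subr_ge0; apply.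
  - by move=> z /andP[sz _]; apply: dV; exact: (le_lt_trans TKT (lt_le_trans sK sz)).
  - by move=> z /andP[sz _]; apply: V1_ge0; exact: lt_le_trans sK sz.
(* The shift [ln 2] doubles the radius; staying beyond [TK + ln 2] makes [V] monotone from radius
   [e^t / 2] on. *)
have sup_bound t th : TK + ln 2 < t -> v (cpt 0 0 (expR t) th) <= 128 * (K * V t).
  move=> tK; have tT : TK < t by lra.
  have h : v (cpt 0 0 (expR t) th) <= 128 * circ v 0 0 (2 * expR t).
    apply: (pointwise_bound (R0 := R0) th oU Cv v_ge0 Bv R00 _ HU).
      by apply: eT; exact: le_lt_trans tT.
    move=> s s' rs ss'; have es : expR (t - ln 2) = expR t / 2.
      by rewrite expRD expRN lnK // posrE.
    have s0 : 0 < s by apply: lt_le_trans rs; rewrite divr_gt0 ?expR_gt0.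
    have s0' : 0 < s' by apply: lt_le_trans ss'.
    have ls : t - ln 2 <= ln s by rewrite -ler_expR es lnK.
    have lss' : ln s <= ln s' by rewrite ler_ln.
    have := @V_mono (ln s) (ln s'); rewrite /V !lnK //; apply=> //.
    by apply: lt_le_trans ls; lra.
  apply: le_trans h _; rewrite ler_pM2l //.
  have := HK t tT; rewrite /V expRD lnK ?posrE //.
  by rewrite [expR t * 2]mulrC.
pose TV := TK + ln 2 + 1; have TVK : TK < TV by rewrite /TV; lra.
have TV0 : T0 < TV by exact: le_lt_trans TVK.
(* Half the mean of [v] at time [TV]: subtracting [c1] costs [V TV / 2 <= V t / 2] in the circular
   integral, so half of it survives. The threshold must not depend on [t], since [e] is chosen after
   it. *)
pose c1 := V TV / (pi *+ 4).
have pi0 := @pi_gt0 R.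
have pi4 : 0 < pi *+ 4 :> R by rewrite mulrn_wgt0.
have c1_gt0 : 0 < c1 by rewrite divr_gt0 // V0.
have [e [e0 He]] := Hf c1 c1_gt0.
have K0 : 0 < K by lra.
have C0 : 0 < C by lra.
have n128 : 0 < 128 :> R by rewrite ltr0n.
have n256 : 0 < 256 :> R by rewrite ltr0n.
have eK : 0 < e / (256 * K) := divr_gt0 e0 (mulr_gt0 n256 K0).
have eKC : 0 < e / (128 * K * C) / (256 * K) :=
  divr_gt0 (divr_gt0 e0 (mulr_gt0 (mulr_gt0 n128 K0) C0)) (mulr_gt0 n256 K0).
have key t : TV < t -> TC < t -> e / (128 * K * C) / (256 * K) / t <= H t.
  move=> tV tC; have tK : TK + ln 2 < t by rewrite /TV in tV; lra.
  have tT : T0 < t by exact: lt_trans tV.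
  have t1 : 1 < t by exact: le_lt_trans tT.
  have t0 : 0 < t by exact: lt_trans t1.
  pose S := 128 * (K * V t).
  have Vt := V0 t tT.
  have S0 : 0 < S by rewrite /S !mulr_gt0.
  (* The slope of the affine minorant times the weight [|y|^(-sigma)], where [sigma = 2 - 2 b]. *)
  pose c2 := expR (- (2 - 2 * b) * t) * (e * S `^ (- b) / S).
  have c2_gt0 : 0 < c2 by rewrite !mulr_gt0 ?expR_gt0 ?invr_gt0 ?powR_gt0.
  have pw a : c2 * (v (cpt 0 0 (expR t) a) - c1) <= - bilaplacian v (cpt 0 0 (expR t) a).
    have Uy : U (cpt 0 0 (expR t) a) by apply: Ur; exact: eT'.
    have I := ineq _ Uy; rewrite enorm_cpt0 ?expR_ge0 // -expRM in I.
    apply: le_trans I; rewrite /c2 -mulrA (mulrC t) ler_wpM2l ?expR_ge0 //.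
    have w0 := v0 _ Uy.
    apply: linear_below_power => //; [exact: ltW|by apply: ltW; exact: f0| |exact: He].
    exact: sup_bound.
  have intg : c2 * (V t / 2) <= - circ (bilaplacian v) 0 0 (expR t).
    have Ut a : U (cpt 0 0 (expR t) a) by apply: Ur; exact: eT'.
    have cv := continuous_circle Cv Ut; have cB := continuous_circle CB Ut.
    have ct1 (g : R -> R) : continuous g -> continuous (fun a => g a - c1).
      by move=> cg a; continuity.
    have ct2 (g : R -> R) (c : R) : continuous g -> continuous (fun a => c * g a).
      by move=> cg a; continuity.
    rewrite -mulN1r -segintZ //.
    apply: (@le_trans _ _ (segint 0 (pi *+ 2) (fun a => c2 * (v (cpt 0 0 (expR t) a) - c1)))).
      rewrite segintZ; last exact: ct1.
      rewrite segintB //; last by move=> a; exact: continuous_at_cst.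
      rewrite segint_cst ?pi2_ge0 // subr0 -/(circ v 0 0 (expR t)) -/(V t).
      rewrite (ler_pM2l c2_gt0).
      have -> : c1 * (pi *+ 2) = V TV / 2.
        rewrite /c1; move: (V TV) (pi : R) pi0 => w p p0; field; exact: lt0r_neq0.
      move: (V_mono TV t TVK (ltW tV)); move: (V t) (V TV) => p q.
      by clear=> ?; lra.
    apply: segint_le; [exact: ct2 (ct1 _ cv) | exact: ct2 | move=> a _].
    by rewrite mulN1r.
  (* The base [128 K C t] is at least 1 and [b <= 1], so its power [b] is at most itself: here
     [t^(-b)] is weakened to [1 / t]. *)
  have SX : S `^ (- b) >= (128 * K * C * t * expR (2 * b * t))^-1.
    have X1 : 1 <= 128 * K * C * t.
      have KC : 1 <= K * C by apply: mulr_ege1.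
      have KCt : 1 <= K * C * t by apply: mulr_ege1 => //; exact: ltW.
      rewrite -!mulrA; lra.
    rewrite powRN lef_pV2 ?posrE ?powR_gt0 ?mulr_gt0 ?expR_gt0 //.
    apply: (@le_trans _ _ ((128 * K * C * t * expR (2 * t)) `^ b)).
      apply: ge0_ler_powR; rewrite ?nnegrE; first exact: ltW.
      - exact: ltW.
      - by rewrite !mulr_ge0 ?expR_ge0 // ltW.
      - rewrite /S -!mulrA ler_pM2l // ler_pM2l //.
        exact: HC.
    have X0 : 0 <= 128 * K * C * t by exact: le_trans X1.
    rewrite powRM ?expR_ge0 //.
    rewrite -expRM (_ : 2 * t * b = 2 * b * t); last ring.
    rewrite ler_wpM2r ?expR_ge0 //; rewrite -[leRHS]powRr1 //.
    exact: ler_powR.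
  have HE : H t = expR (2 * t) * - circ (bilaplacian v) 0 0 (expR t).
    by rewrite /H mulrN.
  rewrite HE.
  apply: (@le_trans _ _ (expR (2 * t) * (c2 * (V t / 2)))); last first.
    by apply: ler_wpM2l => //; exact: expR_ge0.
  (* [V t] cancels against the [1 / S] in [c2], and [e^(2t)] times the weight is [e^(2 b t)],
     precisely the factor in [SX]. *)
  have -> : expR (2 * t) * (c2 * (V t / 2)) = expR (2 * b * t) * S `^ (- b) * (e / (256 * K)).
    have -> : expR (2 * b * t) = expR (2 * t) * expR (- (2 - 2 * b) * t).
      by rewrite -expRD; congr expR; ring.
    rewrite /c2; move: (S `^ (- b)) => q; rewrite /S.
    move: (V t) Vt (expR (2 * t)) (expR (- (2 - 2 * b) * t)) => w w0 E1 E2.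
    by field; rewrite !gt_eqF.
  move: SX; move: (S `^ (- b)) => q.
  have := expR_gt0 (2 * b * t); move: (expR (2 * b * t)) => E E0 SX.
  have h : (128 * K * C * t)^-1 <= E * q.
    rewrite -ler_pdivrMl // mulrC -invfM; exact: SX.
  have -> : e / (128 * K * C) / (256 * K) / t = (128 * K * C * t)^-1 * (e / (256 * K)).
    by field; rewrite !gt_eqF.
  exact: ler_wpM2r (ltW eK) _ _ h.
apply: (radial_contradiction T01 dV dV1 dZ dZ1 H0 V0 (T := Num.max TV TC) _ _
  (c := e / (128 * K * C) / (256 * K))).
- exact: eKC.
- by rewrite le_max (ltW TV0).
- by move=> t; rewrite gt_max => /andP[]; exact: key.
Qed.

End ExteriorDomain.

Theorem theorem1p6 (R : realType) (sigma : R) (Omega : set 'rV[R]_2)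
    (f : R -> R) (k : nat)
    (hsigma0 : 0 <= sigma) (hsigma2 : sigma < 2)
    (hOmega : compact Omega)
    (hf_pos : forall s : R, 0 < s -> 0 < f s)
    (hf_cont : {within `]0, +oo[, continuous f})
    (hk : (2 <= k)%N)
    (hliminf : (0 < limf_einf (fun s : R =>
        ((f s / s `^ (-1 + sigma / 2)) *
         ((\prod_(2 <= i < k.+1) iter_ln i s) / ln s `^ (1 - sigma / 2)))%:E)
        (+oo%R : set_system R))%E) :
  ~ exists v : 'rV[R]_2 -> R, C4_positive_solution sigma f (~` Omega) v.
Proof.
move=> [v [Cv v0 ineq]].
have oU : open (~` Omega) by apply: closed_openC; apply: compact_closed hOmega.
have [R0 [R00 HU]] := exterior_of_compact hOmega.
(* [b = 1 - sigma / 2] lies in [(0, 1]] because [0 <= sigma < 2]. *)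
have b0 : 0 < 1 - sigma / 2 by lra.
rewrite (_ : -1 + sigma / 2 = - (1 - sigma / 2)) in hliminf; last ring.
have [e [S [e0 HS]]] := liminf_gt0_lower_bound b0 hf_pos hliminf.
apply: (no_exterior_solution oU Cv R00 HU v0 b0 _ hf_pos); first lra.
- by move=> c c0; exact: lower_bound_on_ray (ltW b0) c0 e0 hf_pos hf_cont HS.
- move=> p Up; have := ineq p Up.
  by rewrite (_ : - (2 - 2 * (1 - sigma / 2)) = - sigma); last field.
Qed.
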